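(* There exist absolute constants $C_3,C_4\geq 1$ such that the following holds. Let $r\in[1,\infty)$, let $X=(X_1,\ldots,X_n)$ be a log-concave $n$-dimensional random vector, and let $$ d_i:=(\mathbb{E}X_i^2)^{1/2}\ (1\le i\le n),\qquad d:=\left(\sum_{i=1}^n d_i^r\right)^{1/r}. $$ Then for every $p\geq r$, $$ \mathbb{E}\left(\sum_{i=1}^n|X_i|^r\mathbf{1}_{\{|X_i|\geq t d_i\}}\right)^{p/r}\leq \left(C_3\, r\,\sigma_{r,X}(p)\right)^{p}\quad\text{for all } t\geq C_4\, r\log\left(\frac{d}{\sigma_{r,X}(p)}\right). $$
   Context: A random vector $X$ in $\mathbb{R}^n$ is log-concave if its distribution $\mu$ satisfies $\mu(\lambda K+(1-\lambda)L)\geq \mu(K)^{\lambda}\mu(L)^{1-\lambda}$ for all compact nonempty sets $K,L\subset\mathbb{R}^n$ and all $\lambda\in[0,1]$. For $p\geq 1$, $$ \sigma_{r,X}(p):=\sup_{\|t\|_{r'}\leq 1}\left(\mathbb{E}\left|\sum_{i=1}^n t_iX_i\right|^p\right)^{1/p}, $$ where the supremum is over $t\in\mathbb{R}^n$, $r'$ is the Hölder dual of $r$ ($r'=\frac{r}{r-1}$ for $r>1$ and $r'=\infty$ for $r=1$), and $\|\cdot\|_{r'}$ is the $\ell_{r'}$-norm on $\mathbb{R}^n$. $\mathbf{1}_{B}$ denotes the indicator of the event $B$. ''Absolute constant'' means a constant that does not depend on $n$, $r$, $X$, $p$, $t$ or anything else. *)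

(* Defs.v *)
From HB Require Import structures.
From mathcomp Require Export all_boot all_order all_algebra.
From mathcomp Require Export all_classical all_reals all_analysis.

Set Implicit Arguments.
Unset Strict Implicit.
Unset Printing Implicit Defensive.

Import Order.TTheory GRing.Theory Num.Theory.
Import numFieldNormedType.Exports.

Local Open Scope classical_set_scope.
Local Open Scope ring_scope.

Section LogConcave.
Context {R : realType} {n : nat} {disp : measure_display}
  {T : measurableType disp} {P : probability T R}.
Implicit Type X : 'I_n -> {RV P >-> R}.

Definition random_vector X (w : T) : 'rV[R]_n := \row_i X i w.

(* Since the coordinates are measurable, preimages of Borel sets, in particular
   of the compact sets used below, are measurable. *)
Definition vector_law X (A : set 'rV[R]_n) : \bar R :=
  P (random_vector X @^-1` A).

Definition set_conv (l : R) (K L : set 'rV[R]_n) : set 'rV[R]_n :=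
  [set l *: x + (1 - l) *: y | x in K & y in L].

(* [poweR x 0] is 1 for every [x], including 0; at [l = 0] and [l = 1] the
   inequality is thus an equality. *)
Definition log_concave X : Prop :=
  forall (K L : set 'rV[R]_n) (l : R),
    compact K -> compact L -> K !=set0 -> L !=set0 -> 0 <= l <= 1 ->
    (poweR (vector_law X K) l * poweR (vector_law X L) (1 - l)
       <= vector_law X (set_conv l K L))%E.

(* For [q = +oo] the norm [`|v|] of a matrix is the maximum of the absolute
   values of its entries; [-oo] is a dummy case. *)
Definition lq_norm (q : \bar R) (v : 'rV[R]_n) : R :=
  match q with
  | q'%:E => (\sum_(i < n) `|v 0 i| `^ q') `^ q'^-1
  | +oo%E => `|v|
  | -oo%E => 0
  end.

(* [hoelder_conjugate r%:E] is [+oo] for [r = 1] and [r / (r - 1)] for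
   [r > 1]. *)
Definition weak_moment (r : R) X (p : R) : \bar R :=
  ereal_sup [set poweR 'E_P[fun w => (`|\sum_(i < n) v 0 i * X i w| `^ p)%R]%E p^-1
            | v in [set v : 'rV[R]_n | lq_norm (hoelder_conjugate r%:E) v <= 1]].

Definition coord_L2 X (i : 'I_n) : R :=
  (fine 'E_P[fun w => (X i w ^+ 2)%R]%E) `^ 2^-1.

End LogConcave.

(* Main.v *)
Require Import Defs.
From mathcomp Require Import all_boot all_order all_algebra.
From mathcomp Require Import all_classical all_reals all_analysis.
From mathcomp Require Import finmap measurable_realfun.
From mathcomp Require Import ring lra.

Set Implicit Arguments.
Unset Strict Implicit.
Unset Printing Implicit Defensive.

Import Order.TTheory GRing.Theory Num.Theory.
Import numFieldNormedType.Exports.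

Local Open Scope classical_set_scope.
Local Open Scope ring_scope.

(* A cell is a convex F_sigma set cut out by half-spaces. Log-concavity restricts
   to cells, so by Borell's lemma linear functionals have exponential tails on
   each cell.

   Key estimate: let [B] be a cell of mass [exp (- U)] and [M_i] the mean of
   [|X_i|] on [B]; then the [l_r] norm of the [M_i] that are much larger than
   [d_i] is at most [C * sigma * (1 + U / p)]. By duality, one bounds
   [\sum_i v_i M_i] for [v] in the unit ball of [l_r']. Cut [B] repeatedly into
   three slabs along coordinates in which it is spread, i.e. both outer slabs
   carry a fixed fraction of its mass and are far apart compared with [d_i].
   The leaves that are still spread after [k] cuts have small total mass: their
   convex combinations (with a small weight [l] on the leaf) with the points [z]
   such that [\sum (z_i / d_i)^2 <= 2 k] along the branch have mass at least
   [mass(leaf)^l / 2] and stay roughly consistent with all cuts of the branch,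
   while no point is consistent with both outer slabs of a cut, so that the sum
   of the masses weighted by consistency loses a factor [1 - delta / 2] at each
   level. On the other leaves each [X_i] deviates from its mean by [O(d_i)], and
   the vector of means is controlled by testing it against [(+- v_i)_i] with the
   exponential moments of [\sum_i +- v_i X_i].

   The moments of the cut-off sum over cells are then bounded by induction on
   the exponent: one factor is expanded over the coordinates [i] and the layers
   [|X_i| >= k h_i], each of which is a union of two cells whose mass decays
   exponentially in [k]. Coordinates with large [M_i] are summed by the key
   estimate, the others by the threshold on [t]. *)

(** * Integration over layers *)

Section Layers.
Context {R : realType}.

Lemma nneseries_geometric_le (u : nat -> \bar R) (C q : R) :
  0 <= C -> 0 <= q < 1 -> (forall k, 0 <= u k)%E ->
  (forall k, u k <= (C * q ^+ k)%:E)%E ->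
  (\sum_(0 <= k <oo) u k <= (C / (1 - q))%:E)%E.
Proof.
move=> C0 /andP[q0 q1] u0 uC; apply: lime_le.
  by apply: is_cvg_nneseries => k _ _; exact: u0.
apply: nearW => N.
apply: (@le_trans _ _ (\sum_(0 <= k < N) (C * q ^+ k)%:E)%E).
  by apply: lee_sum => k _; exact: uC.
rewrite sumEFin lee_fin -mulr_sumr ler_wpM2l//.
rewrite -[leRHS]mul1r ler_pdivlMr ?subr_gt0// mulrC big_mkord.
have := subrX1 q N; rewrite -opprB -[in RHS]opprB mulNr => /oppr_inj <-.
by rewrite gerBl exprn_ge0.
Qed.

Context {disp : measure_display} {T : measurableType disp}
  {mu : {measure set T -> \bar R}}.

(** At each point a single term of the series already dominates [g * h], so the sets [E k] may
    overlap and need not be differences of levels. The factor [h] is extended-real; it will be a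
    power of the cut-off sum. *)
Lemma integral_layers_le (D : set T) (E : nat -> set T) (g : T -> R)
    (h : T -> \bar R) (c : nat -> R) :
  measurable D -> (forall k, measurable (E k)) ->
  measurable_fun D g -> (forall w, 0 <= g w) ->
  measurable_fun D h -> (forall w, 0 <= h w)%E ->
  (forall k, 0 <= c k) ->
  (forall w, D w -> exists2 k, E k w & g w <= c k) ->
  (\int[mu]_(w in D) ((g w)%:E * h w) <=
   \sum_(0 <= k <oo) (c k)%:E * \int[mu]_(w in D `&` E k) h w)%E.
Proof.
move=> mD mE mg g0 mh h0 c0 gE.
have mterm k : measurable_fun D (fun w => (c k)%:E * (h \_ (E k)) w)%E.
  apply: measurable_funeM; apply/measurable_restrict => //.
  by apply: measurable_funS mh => //; exact: subIsetl.
have term0 k w : (0 <= (c k)%:E * (h \_ (E k)) w)%E.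
  by apply: mule_ge0; rewrite ?lee_fin// erestrict_ge0.
rewrite (_ : (\sum_(0 <= k <oo) _)%E = (\int[mu]_(w in D)
    \sum_(0 <= k <oo) ((c k)%:E * (h \_ (E k)) w))%E); last first.
  rewrite integral_nneseries//.
  apply: eq_eseriesr => k _; rewrite ge0_integralZl_EFin//.
  - by rewrite integral_mkcondr.
  - by move=> w _; rewrite erestrict_ge0.
  - apply/measurable_restrict => //.
    by apply: measurable_funS mh => //; exact: subIsetl.
apply: ge0_le_integral => //.
- by move=> w _; apply: mule_ge0; rewrite ?lee_fin.
- by apply: emeasurable_funM => //; exact/measurable_EFinP.
- exact: (@ge0_emeasurable_sum _ _ _ _ _ xpredT).
- move=> w Dw; have [k Ek gk] := gE w Dw.
  apply: (@le_trans _ _ ((c k)%:E * (h \_ (E k)) w)%E).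
    rewrite patchE mem_set//; apply: lee_wpmul2r => //; by rewrite lee_fin.
  apply: (@le_trans _ _ (\sum_(0 <= j < k.+1) ((c j)%:E * (h \_ (E j)) w))%E).
    by rewrite big_nat_recr//= leeDr// sume_ge0.
  exact: nneseries_lim_ge.
Qed.
End Layers.

(** * Elementary inequalities *)

Lemma expR_half_bound (K : realType) (p : K) :
  1 <= p -> expR (- p) + expR (- (p / 2)) <= 1.
Proof.
move=> p1; set s := expR (- (p / 2)).
have s0 : 0 < s by exact: expR_gt0.
have -> : expR (- p) = s ^+ 2.
  by rewrite /s expr2 -expRD; congr expR; lra.
(* The conclusion [s ^+ 2 + s <= 1] needs [s] below the inverse golden ratio [0.618...]. Applying
   [1 + x <= expR x] to the whole exponent only gives [2 / 3]; applied to an eighth of it, it gives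
   [0.6157...]. *)
have : s <= (16 / 17) ^+ 8.
  rewrite (_ : s = expR (- (p / 16)) ^+ 8); last first.
    by rewrite -expRM_natl; congr expR; lra.
  apply: lerXn2r; rewrite ?nnegrE ?expR_ge0//.
  rewrite expRN -[leRHS]invrK lef_pV2 ?posrE ?expR_gt0//.
  by apply: le_trans (expR_ge1Dx _); lra.
nra.
Qed.

Lemma expRN1_ge (K : realType) : 1 / 4 <= expR (- 1) :> K.
Proof.
have -> : - 1 = - 2^-1 + - 2^-1 :> K by lra.
rewrite expRD; have := expR_ge1Dx (- 2^-1 : K); nra.
Qed.

Lemma expR1_le4 (K : realType) : expR 1 <= 4 :> K.
Proof.
rewrite -[expR 1]invrK -expRN -[leRHS]invrK lef_pV2 ?posrE ?expR_gt0//.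
by apply: le_trans (expRN1_ge K); lra.
Qed.

Lemma sqr_le_expR (K : realType) (x : K) : 0 <= x -> x ^+ 2 <= 4 * expR x.
Proof.
move=> x0; have -> : expR x = expR (x / 2) ^+ 2.
  by rewrite expr2 -expRD -splitr.
have := expR_ge1Dx (x / 2); nra.
Qed.

(** This is [t * x / q <= expR (t * x / q)] raised to the power [q]. *)
Lemma powR_le_expR (K : realType) (q t x : K) : 0 < q -> 0 < t -> 0 <= x ->
  x `^ q <= (q / t) `^ q * expR (t * x).
Proof.
move=> q0 t0 x0.
have -> : expR (t * x) = expR (t * x / q) `^ q.
  by rewrite /powR gt_eqF ?expR_gt0// expRK; congr expR; field; rewrite gt_eqF.
have qt0 : 0 <= q / t by rewrite divr_ge0// ltW.
rewrite -powRM ?expR_ge0//.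
apply: ge0_ler_powR; rewrite ?nnegrE//; [exact: ltW|by apply: mulr_ge0; rewrite ?expR_ge0|].
have h := expR_ge1Dx (t * x / q).
apply: (@le_trans _ _ (q / t * (t * x / q))); last first.
  by rewrite ler_pM2l ?divr_gt0//; lra.
by rewrite le_eqVlt; apply/orP; left; apply/eqP; field; rewrite !gt_eqF.
Qed.

(* With [x = pr B], the integral of the [m]-th power of the cut-off sum over a
   cell [B] is bounded by [D ^+ m * mass_growth p (r * m%:R) x]; the logarithmic
   factor absorbs the growth of [wide_powR_sum_le] as the mass of [B] decreases.
*)
Definition mass_growth (K : realType) (p N x : K) : K :=
  x * (1 - ln x / (4 * p)) `^ N.

(** When the mass drops from [y] to [x], the logarithmic factor grows by at most [expR (N * z)] with
    [z = (ln y - ln x) / (4 * p)]. As [N <= 2 * p], this is at most [expR ((ln y - ln x) / 2)]: half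
    of the decay of the mass survives. *)
Lemma mass_growth_le (K : realType) (p N x y e : K) :
  0 < p -> 0 <= N -> N <= 2 * p ->
  0 <= x -> x <= y -> 0 < y -> y <= 1 -> x <= expR (- e) * y ->
  mass_growth p N x <= expR (- (e / 2)) * mass_growth p N y.
Proof.
move=> p0 N0 Np x0 xy y0 y1 xey; rewrite /mass_growth.
have [->|xn0] := eqVneq x 0.
  by rewrite mul0r !mulr_ge0 ?expR_ge0 ?powR_ge0// ltW.
have {x0 xn0} x0 : 0 < x by rewrite lt_neqAle eq_sym xn0.
have lny : ln y <= 0 by exact: ln_le0.
have D0 : 0 <= ln y - ln x by rewrite subr_ge0 ler_ln ?posrE.
have eD : e <= ln y - ln x.
  move: xey; rewrite -ler_ln ?posrE ?mulr_gt0 ?expR_gt0//.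
  by rewrite lnM ?posrE ?expR_gt0// expRK; lra.
have p40 : 0 < 4 * p by rewrite mulr_gt0.
set a := 1 - ln y / (4 * p); set b := 1 - ln x / (4 * p).
pose z := (ln y - ln x) / (4 * p).
have z0 : 0 <= z by rewrite divr_ge0// ltW.
have a1 : 1 <= a by rewrite /a lerBrDl gerDr pmulr_lle0 ?invr_gt0.
have ba : b = a + z by rewrite /a /b /z; field; rewrite gt_eqF.
have b0 : 0 <= b by rewrite ba; lra.
have bN : b `^ N <= expR ((ln y - ln x) / 2) * a `^ N.
  apply: (@le_trans _ _ ((expR z * a) `^ N)).
    apply: ge0_ler_powR => //; rewrite ?nnegrE ?mulr_ge0 ?expR_ge0//; first lra.
    by have := expR_ge1Dx z; nra.
  rewrite powRM ?expR_ge0//; last lra.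
  rewrite ler_wpM2r ?powR_ge0// /powR gt_eqF ?expR_gt0// expRK ler_expR.
  apply: (@le_trans _ _ (2 * p * z)); first by rewrite ler_wpM2r.
  by rewrite /z le_eqVlt; apply/orP; left; apply/eqP; field; rewrite gt_eqF.
apply: le_trans (ler_wpM2l (ltW x0) bN) _.
rewrite !mulrA ler_wpM2r ?powR_ge0//.
rewrite -{1}(lnK (_ : x \is Num.pos)) ?posrE//.
rewrite -{2}(lnK (_ : y \is Num.pos)) ?posrE// -!expRD ler_expR.
lra.
Qed.

Lemma nneseries_geometric_le1 (K : realType) (u : nat -> \bar K) (c C q : K) :
  0 <= C -> 0 <= q < 1 -> (forall k, 0 <= u k)%E ->
  (u 0%N <= c%:E)%E -> (forall k, u k.+1 <= (C * q ^+ k)%:E)%E ->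
  (\sum_(0 <= k <oo) u k <= (c + C / (1 - q))%:E)%E.
Proof.
move=> C0 /andP[q0 q1] u0 uc uC; apply: lime_le.
  by apply: is_cvg_nneseries => k _ _; exact: u0.
have CC : 0 <= C / (1 - q) by rewrite divr_ge0// subr_ge0 ltW.
have c0 : 0 <= c by rewrite -lee_fin; apply: le_trans uc.
apply: nearW => -[|N]; first by rewrite big_geq// lee_fin addr_ge0.
rewrite big_nat_recl// EFinD; apply: leeD => //.
apply: (@le_trans _ _ (\sum_(0 <= k < N) (C * q ^+ k)%:E)%E).
  by apply: lee_sum => k _; exact: uC.
rewrite sumEFin lee_fin -mulr_sumr ler_wpM2l//.
rewrite -[leRHS]mul1r ler_pdivlMr ?subr_gt0// mulrC big_mkord.
have := subrX1 q N; rewrite -opprB -[in RHS]opprB mulNr => /oppr_inj <-.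
by rewrite gerBl exprn_ge0.
Qed.

(** * Duality between [l_r] and its Hoelder conjugate *)

Lemma hoelder_conjugate_gt1 (K : realType) (r : K) : 1 < r ->
  hoelder_conjugate r%:E = (r / (r - 1))%:E.
Proof.
move=> r1; have r0 : 0 < r by lra.
have r1' : 0 < r - 1 by lra.
rewrite /hoelder_conjugate/= eqe gt_eqF//.
by rewrite -EFinB inver gt_eqF// EFinM.
Qed.

(** The bound on [u] is the extremal vector of Hoelder's inequality for [a] restricted to [Q]: since
    [(r - 1) * r' = r], the [r']-th powers of its entries sum to 1. For [r = 1] its entries are 0 or
    1 and the norm is the maximum. *)
Lemma lq_norm_hoelder_conjugate_le1 (K : realType) (n : nat) (r : K)
    (a : 'I_n -> K) (Q : pred 'I_n) (u : 'rV[K]_n) (T := \sum_(i < n | Q i) a i `^ r) :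
  1 <= r -> (forall i, 0 <= a i) -> 0 < T ->
  (forall i, `|u 0 i| <= if Q i then a i `^ (r - 1) / T `^ ((r - 1) / r) else 0) ->
  lq_norm (hoelder_conjugate r%:E) u <= 1.
Proof.
move=> r1 a0 T0 ule.
have r0 : 0 < r by lra.
have [rE|rn1] := eqVneq r 1.
  rewrite rE hoelder_conjugate1 /= /Num.norm/= mx_normrE.
  apply/bigmax_leP; split=> // -[i j] _ /=; rewrite ord1.
  apply: le_trans (ule j) _; case: ifP => _//.
  by rewrite rE subrr mul0r !powRr0 divr1.
have {rn1} r1' : 0 < r - 1 by rewrite subr_gt0 lt_neqAle eq_sym rn1.
rewrite hoelder_conjugate_gt1; last by rewrite -subr_gt0.
rewrite /lq_norm; set q := r / (r - 1).
have q0 : 0 < q by rewrite divr_gt0.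
have qE1 : (r - 1) * q = r by rewrite /q mulrC divfK// gt_eqF.
have S1 : \sum_(i < n) `|u 0 i| `^ q <= 1.
  apply: (@le_trans _ _ (\sum_(i < n | Q i) a i `^ r / T)); last first.
    by rewrite -mulr_suml divff// gt_eqF.
  rewrite [leRHS]big_mkcond; apply: ler_sum => i _.
  apply: (@le_trans _ _ ((if Q i then a i `^ (r - 1) / T `^ ((r - 1) / r) else 0) `^ q)).
    apply: ge0_ler_powR; rewrite ?nnegrE//; first exact: ltW.
    by case: ifP => _//; rewrite divr_ge0 ?powR_ge0.
  case: ifP => _; last by rewrite powR0// gt_eqF.
  rewrite powRM ?powR_ge0 ?invr_ge0 ?powR_ge0// -powRrM qE1.
  rewrite -powRN -[(T `^ _) `^ q]powRrM.
  rewrite (_ : - ((r - 1) / r) * q = - 1); last first.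
    by rewrite mulNr mulrAC qE1 divff// gt_eqF.
  by rewrite powRN powRr1// ltW.
apply: (@le_trans _ _ (1 `^ q^-1)); last by rewrite powR1.
apply: ge0_ler_powR; rewrite ?nnegrE//.
  by rewrite invr_ge0 ltW.
by rewrite sumr_ge0// => i _; exact: powR_ge0.
Qed.

(** Only the extremal vector is tested. The hypothesis is restricted to those [v] for which every
    [u] dominated by [v] lies in the dual ball, because [spread_sum_le] changes signs of entries of
    [v] and replaces others by 0. *)
Lemma lr_sum_duality (K : realType) (n : nat) (r S : K) (a : 'I_n -> K)
    (Q : pred 'I_n) :
  1 <= r -> 0 <= S -> (forall i, 0 <= a i) ->
  (forall v : 'rV[K]_n, (forall i, 0 <= v 0 i) ->
    (forall u : 'rV[K]_n, (forall i, `|u 0 i| <= v 0 i) ->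
      lq_norm (hoelder_conjugate r%:E) u <= 1) ->
    \sum_(i < n | Q i) v 0 i * a i <= S) ->
  \sum_(i < n | Q i) a i `^ r <= S `^ r.
Proof.
move=> r1 S0 a0 h; set T := \sum_(i < n | Q i) _.
have r0 : 0 < r by lra.
have [T0|] := leP T 0; first exact: le_trans T0 (powR_ge0 _ _).
move=> T0.
pose v : 'rV[K]_n := \row_i (if Q i then a i `^ (r - 1) / T `^ ((r - 1) / r) else 0).
have v0 i : 0 <= v 0 i.
  by rewrite mxE; case: ifP => _//; rewrite divr_ge0 ?powR_ge0.
have := h v v0.
have -> : \sum_(i < n | Q i) v 0 i * a i = T `^ r^-1.
  transitivity (\sum_(i < n | Q i) a i `^ r / T `^ ((r - 1) / r)).
    apply: eq_bigr => i Qi; rewrite mxE Qi mulrAC; congr (_ / _).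
    by rewrite mulrC mulr_powRB1.
  rewrite -mulr_suml -/T -[X in X / _](powRr1 (ltW T0)) -powRB; last first.
    by rewrite (gt_eqF T0) implybT.
  by congr (_ `^ _); field; rewrite gt_eqF.
move=> hv; have TS : T `^ r^-1 <= S.
  apply: hv => u ule; apply: (@lq_norm_hoelder_conjugate_le1 _ _ _ a Q) => // i.
  by apply: le_trans (ule i) _; rewrite mxE.
have -> : T = (T `^ r^-1) `^ r by rewrite -powRrM mulVf ?gt_eqF// powRr1// ltW.
by apply: ge0_ler_powR; rewrite ?nnegrE ?powR_ge0// ltW.
Qed.

Lemma lq_norm_hoelder_conjugate_coord (K : realType) (m : nat) (r : K) (u : 'rV[K]_m) i :
  1 <= r -> lq_norm (hoelder_conjugate r%:E) u <= 1 -> `|u 0 i| <= 1.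
Proof.
move=> r1; have [->|rn1] := eqVneq r 1.
  rewrite hoelder_conjugate1 /= /Num.norm/= mx_normrE.
  by move=> /bigmax_leP[_ /(_ (0, i) isT)].
have {rn1} r1' : 0 < r - 1 by rewrite subr_gt0 lt_neqAle eq_sym rn1.
rewrite hoelder_conjugate_gt1; last by rewrite -subr_gt0.
rewrite /lq_norm; set q := r / (r - 1) => h.
have q0 : 0 < q by rewrite divr_gt0//; lra.
rewrite leNgt; apply/negP => ui; move: h; apply/negP; rewrite -ltNge.
have -> : 1 = 1 `^ q^-1 :> K by rewrite powR1.
apply: gt0_ltr_powR; rewrite ?invr_gt0 ?nnegrE//.
  by rewrite sumr_ge0// => j _; exact: powR_ge0.
apply: (@lt_le_trans _ _ (`|u 0 i| `^ q)).
  have -> : 1 = 1 `^ q :> K by rewrite powR1.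
  by apply: gt0_ltr_powR; rewrite ?nnegrE.
by rewrite (bigD1 i)//= lerDl sumr_ge0// => j _; exact: powR_ge0.
Qed.

Lemma lq_norm_delta_le1 (K : realType) (m : nat) (r : K) (i : 'I_m) :
  1 <= r -> lq_norm (hoelder_conjugate r%:E) (delta_mx 0 i : 'rV_m) <= 1.
Proof.
move=> r1; apply: (@lq_norm_hoelder_conjugate_le1 _ _ _ (fun=> 1) (pred1 i)) => //.
  by rewrite big_pred1_eq powR1.
move=> j; rewrite big_pred1_eq !powR1 divr1 mxE eqxx /=.
by case: eqVneq => _; rewrite ?normr1 ?normr0.
Qed.

(** The sum is at most [m] times its largest [|x i|]. This crude bound only serves to show that the
    weak moment is finite. *)
Lemma powR_norm_sum_le (K : realType) (m : nat) (p : K) (v x : 'I_m -> K) :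
  0 < p -> (forall i, `|v i| <= 1) ->
  `|\sum_(i < m) v i * x i| `^ p <= \sum_(i < m) `|m%:R * x i| `^ p.
Proof.
move=> p0 v1; case: m v x v1 => [|m] v x v1.
  by rewrite !big_ord0 normr0 powR0// gt_eqF.
case: (@arg_maxP _ _ _ (ord0 : 'I_m.+1) xpredT (fun i => `|x i|) isT) => i _ xi.
apply: (@le_trans _ _ (`|m.+1%:R * x i| `^ p)); last first.
  by rewrite (bigD1 i)//= lerDl sumr_ge0// => j _; exact: powR_ge0.
apply: ge0_ler_powR; rewrite ?nnegrE ?(ltW p0)//.
apply: le_trans (ler_norm_sum _ _ _) _.
apply: (@le_trans _ _ (\sum_(j < m.+1) `|x i|)).
  by apply: ler_sum => j _; rewrite normrM -[leRHS]mul1r; apply: ler_pM => //; exact: xi.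
by rewrite sumr_const card_ord normrM normr_nat mulr_natl.
Qed.

(** * Countable unions of compact sets *)

Section SigmaCompact.
Context {R : realType} {n : nat}.
Implicit Types (F G : set 'rV[R]_n) (l : R).

(** Log-concavity is assumed for compact sets only, while cells may be unbounded or cut by strict
    inequalities. Increasing unions of compact sets contain the cells, are stable under [set_conv],
    and are reached by continuity of the law from below. *)
Definition sigma_compact F : Prop :=
  exists K : nat -> set 'rV[R]_n,
    [/\ forall m, compact (K m), nondecreasing_seq K & F = \bigcup_m K m].

Definition cube (m : nat) : set 'rV[R]_n :=
  [set v | forall i, v ord0 i \in `[(- m%:R), m%:R]].

Lemma compact_cube m : compact (cube m).
Proof.
rewrite /cube; apply: (@rV_compact R n (fun=> `[(- m%:R), m%:R]%classic)) => _.
exact: segment_compact.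
Qed.

Lemma cubeP m (y : 'rV[R]_n) : cube m y <-> forall i, `|y 0 i| <= m%:R.
Proof.
by split => h i; have := h i; rewrite /= in_itv/= ler_norml.
Qed.

Lemma sigma_compact_bigcup_closed (G : nat -> set 'rV[R]_n) :
  (forall m, closed (G m)) -> nondecreasing_seq G ->
  sigma_compact (\bigcup_m G m).
Proof.
move=> cG ndG.
exists (fun m => cube m `&` G m); split.
- by move=> m; apply: compact_closedI => //; exact: compact_cube.
- move=> m m' mm'; apply/subsetPset => y [/cubeP ym Gy]; split.
    by apply/cubeP => i; rewrite (le_trans (ym i))// ler_nat.
  by move/subsetPset: (ndG _ _ mm'); apply.
- apply/seteqP; split => [y [m _ Gy]|y [m _ [_ Gy]]]; last by exists m.
  exists (maxn m (Num.truncn (\sum_i `|y 0 i|)).+1) => //; split.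
    apply/cubeP => i; apply: (@le_trans _ _ (\sum_i `|y 0 i|)).
      by rewrite (bigD1 i)//= lerDl sumr_ge0.
    by rewrite ltW// (lt_le_trans (truncnS_gt _))// ler_nat leq_maxr.
  by move/subsetPset: (ndG _ _ (leq_maxl m (Num.truncn (\sum_i `|y 0 i|)).+1)); apply.
Qed.

Lemma closed_sigma_compact F : closed F -> sigma_compact F.
Proof.
move=> cF; rewrite -(_ : \bigcup_(m in setT) (fun _ : nat => F) m = F); last first.
  by apply/seteqP; split => [x [_ _]//|x Fx]; exists 0%N.
by apply: sigma_compact_bigcup_closed => // m m' _; exact/subsetPset.
Qed.

Lemma compact_sigma_compact F : compact F -> sigma_compact F.
Proof.
move=> cF; apply: closed_sigma_compact; exact: compact_closed.
Qed.

Lemma sigma_compactI F G :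
  sigma_compact F -> sigma_compact G -> sigma_compact (F `&` G).
Proof.
move=> [K [cK ndK ->]] [L [cL ndL ->]].
exists (fun m => K m `&` L m); split.
- move=> m; apply: compact_closedI => //.
  exact: compact_closed.
- move=> m m' mm'; apply/subsetPset => x [Kx Lx]; split.
  + by move/subsetPset: (ndK _ _ mm'); apply.
  + by move/subsetPset: (ndL _ _ mm'); apply.
- apply/seteqP; split => [x [[m _ Kx] [m' _ Lx]]|x [m _ [Kx Lx]]]; last first.
    by split; exists m.
  exists (maxn m m') => //; split.
  + by move/subsetPset: (ndK _ _ (leq_maxl m m')); apply.
  + by move/subsetPset: (ndL _ _ (leq_maxr m m')); apply.
Qed.

(** The open sublevel set is the increasing union of the closed ones at the levels
    [a - m.+1%:R^-1]. *)
Lemma sigma_compact_lt (f : 'rV[R]_n -> R) (a : R) :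
  continuous f -> sigma_compact [set x | f x < a].
Proof.
move=> cf.
rewrite (_ : [set x | f x < a] =
  \bigcup_m [set x | f x <= a - m.+1%:R^-1]); last first.
  apply/seteqP; split => [x /= fa|x [m _ /= fa]]; last first.
    by rewrite (le_lt_trans fa)// ltrBlDr ltrDl invr_gt0.
  exists (Num.truncn (a - f x)^-1) => //=.
  rewrite lerBrDr -lerBrDl invf_ple ?posrE ?subr_gt0//.
  by rewrite ltW// truncnS_gt.
apply: sigma_compact_bigcup_closed => [m|m m' mm'].
  apply: (@preimage_closed _ _ f [set z : R | z <= a - m.+1%:R^-1]).
    by [].
  exact: closed_le.
apply/subsetPset => x /= /le_trans; apply.
by rewrite lerD2l lerN2 lef_pV2 ?posrE// ler_nat.
Qed.

Lemma compact_set_conv (K L : set 'rV[R]_n) l :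
  compact K -> compact L -> compact (set_conv l K L).
Proof.
move=> cK cL.
rewrite (_ : set_conv l K L =
  (fun z : 'rV[R]_n * 'rV[R]_n => l *: z.1 + (1 - l) *: z.2) @` (K `*` L)).
  apply: continuous_compact; last exact: compact_setX.
  apply: continuous_subspaceT => z; apply: cvgD; apply: cvgZr.
    exact: cvg_fst.
  exact: cvg_snd.
apply/seteqP; split => [_ [x Kx [y Ly <-]]|_ [[x y] [/= Kx Ly] <-]].
  by exists (x, y).
by exists x => //; exists y.
Qed.

Lemma sigma_compact_set_conv F G l :
  sigma_compact F -> sigma_compact G -> sigma_compact (set_conv l F G).
Proof.
move=> [K [cK ndK ->]] [L [cL ndL ->]].
exists (fun m => set_conv l (K m) (L m)); split.
- by move=> m; exact: compact_set_conv.
- move=> m m' mm'; apply/subsetPset => _ [x Kx [y Ly <-]].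
  exists x; first by move/subsetPset: (ndK _ _ mm'); apply.
  by exists y => //; move/subsetPset: (ndL _ _ mm'); apply.
- apply/seteqP; split => [_ [x [m _ Kx] [y [m' _ Ly] <-]]|
      _ [m _ [x Kx [y Ly <-]]]]; last first.
    by exists x; [exists m|exists y => //; exists m].
  exists (maxn m m') => //; exists x.
    by move/subsetPset: (ndK _ _ (leq_maxl m m')); apply.
  by exists y => //; move/subsetPset: (ndL _ _ (leq_maxr m m')); apply.
Qed.

End SigmaCompact.

(** * The law of [X] on countable unions of compact sets *)

Section Law.
Context {R : realType} {n : nat} {disp : measure_display}
  {T : measurableType disp} {P : probability T R} (X : 'I_n -> {RV P >-> R}).
Implicit Types (A B F G H : set 'rV[R]_n) (l a b c : R) (v : 'rV[R]_n).

Local Notation V := (random_vector X).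

Lemma measurable_ball_preimage (q : 'rV[R]_n) (e : R) :
  measurable (V @^-1` [set x | forall i, `|q 0 i - x 0 i| < e]).
Proof.
rewrite (_ : _ @^-1` _ =
  \big[setI/setT]_(i <- index_enum 'I_n) [set w | `|q 0 i - X i w| < e]).
  apply: bigsetI_measurable => i _.
  rewrite (_ : [set w | _] = X i @^-1` ball (q 0 i) e)//.
  rewrite -[X in measurable X]setTI; apply: measurable_funPT => //.
  exact: measurable_ball.
rewrite -bigcap_seq; apply/seteqP; split => [w /= h i _ /=|w h i].
  by have := h i; rewrite mxE.
by rewrite mxE; apply: h => /=; exact: mem_index_enum.
Qed.

(** A compact set is covered, for each [m], by finitely many sup-norm balls of radius [m.+1%:R^-1]
    centred in it. Being closed, it is the intersection over [m] of these finite unions, and the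
    preimage of a ball is a finite intersection of coordinate events. *)
Lemma measurable_compact_preimage F : compact F -> measurable (V @^-1` F).
Proof.
move=> cF.
have cov (m : nat) : exists D : {fset 'rV[R]_n},
    {subset D <= F} /\
    F `<=` \bigcup_(q in [set` D]) [set x | forall i, `|q 0 i - x 0 i| < m.+1%:R^-1].
  move: (cF); rewrite compact_cover => /(_ _ F (fun q => ball q m.+1%:R^-1)).
  case=> [q Fq||D DF FD].
  - exact: ball_open.
  - by move=> x Fx; exists x => //; exact: ballxx.
  exists D; split => // x /FD[q Dq [_ qx]]; exists q => // i.
  exact: qx.
have /choice[D DF] := cov.
rewrite (_ : V @^-1` F = \bigcap_m \bigcup_(q in [set` D m])
   (V @^-1` [set x | forall i, `|q 0 i - x 0 i| < m.+1%:R^-1])).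
  apply: bigcap_measurable => //= m _.
  apply: fin_bigcup_measurable => [|q _]; first exact: finite_fset.
  exact: measurable_ball_preimage.
apply/seteqP; split => [w Fw m _|w h].
  by have [_ /(_ _ Fw)] := DF m.
have : closed F by exact: compact_closed.
apply => B /nbhs_ballP[e /= e0 eB].
pose m := Num.truncn e^-1.
have [q Dq qw] := h m I.
exists q; split; first by apply: set_mem; exact: (proj1 (DF m)).
apply: eB; split => // i j; rewrite ord1 /ball/= distrC.
apply: (lt_le_trans (qw j)).
by rewrite invf_ple ?posrE// ltW// truncnS_gt.
Qed.

Lemma sigma_compact_measurable F : sigma_compact F -> measurable (V @^-1` F).
Proof.
move=> [K [cK _ ->]]; rewrite preimage_bigcup.
by apply: bigcup_measurable => m _; exact: measurable_compact_preimage.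
Qed.

Definition pr F : R := fine (P (V @^-1` F)).

Lemma pr_fineK F : sigma_compact F -> (pr F)%:E = P (V @^-1` F).
Proof.
by move=> /sigma_compact_measurable mF; rewrite /pr fineK// fin_num_measure.
Qed.

Lemma pr_ge0 F : 0 <= pr F.
Proof. exact: fine_ge0. Qed.

Lemma le_pr F G : sigma_compact F -> sigma_compact G -> F `<=` G -> pr F <= pr G.
Proof.
move=> cF cG FG; rewrite -lee_fin !pr_fineK//.
apply: le_measure; try (by apply: mem_set; exact: sigma_compact_measurable).
by move=> w; exact: FG.
Qed.

Lemma pr_le1 F : sigma_compact F -> pr F <= 1.
Proof.
by move=> cF; rewrite -lee_fin pr_fineK// probability_le1//; exact: sigma_compact_measurable.
Qed.

Context (lcX : log_concave X).

(** The inequality holds for the compact sets exhausting [F] and [G], and passes to the limit by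
    continuity from below. For [0 < l < 1] a null set makes the left side 0, so only positive masses
    remain, at which the powers are continuous. *)
Lemma log_concave_sigma_compact F G l :
  0 < l < 1 -> sigma_compact F -> sigma_compact G ->
  pr F `^ l * pr G `^ (1 - l) <= pr (set_conv l F G).
Proof.
move=> /andP[l0 l1] [K [cK ndK FE]] [L [cL ndL GE]].
have scF : sigma_compact F by exists K.
have scG : sigma_compact G by exists L.
have [->|F0] := eqVneq (pr F) 0.
  by rewrite powR0 ?mul0r ?pr_ge0 ?gt_eqF.
have [->|G0] := eqVneq (pr G) 0.
  by rewrite powR0 ?mulr0 ?pr_ge0// subr_eq0 gt_eqF.
have cvgpr (E : set 'rV[R]_n) (J : nat -> set 'rV[R]_n) :
    (forall m, compact (J m)) -> nondecreasing_seq J ->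
    E = \bigcup_m J m -> pr (J m) @[m --> \oo] --> pr E.
  move=> cJ ndJ EE.
  have scE : sigma_compact E by exists J.
  have mJ m := measurable_compact_preimage (cJ m).
  have : (P (V @^-1` J m) @[m --> \oo] --> P (\bigcup_m (V @^-1` J m))).
    apply: nondecreasing_cvg_mu => //; first exact: bigcup_measurable.
    move=> m m' mm'; apply/subsetPset; apply: preimage_subset.
    exact/subsetPset/ndJ.
  rewrite -preimage_bigcup -EE -pr_fineK// => h.
  by apply: fine_cvg.
have cvgpow (u : nat -> R) (a x : R) : 0 < x -> u @ \oo --> x ->
    (u m `^ a) @[m --> \oo] --> x `^ a.
  move=> x0 ux.
  rewrite (_ : x `^ a = expR (a * ln x)); last by rewrite /powR gt_eqF.
  have h : (expR (a * ln (u m))) @[m --> \oo] --> expR (a * ln x).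
    apply: continuous_cvg; first exact: continuous_expR.
    apply: cvgMr; apply: continuous_cvg => //; exact: continuous_ln.
  apply: cvg_trans h; apply: near_eq_cvg; near=> m.
  by rewrite /powR gt_eqF//; near: m; exact: (cvgr_gt x).
have F1 : 0 < pr F by rewrite lt_neqAle eq_sym F0 pr_ge0.
have G1 : 0 < pr G by rewrite lt_neqAle eq_sym G0 pr_ge0.
have h : (pr (K m) `^ l * pr (L m) `^ (1 - l)) @[m --> \oo] -->
    pr F `^ l * pr G `^ (1 - l).
  by apply: cvgM; apply: cvgpow => //; exact: cvgpr.
apply: (cvgr_to_le h); apply: nearW => m.
(* The first compact sets of an exhaustion may be empty, where [log_concave] says nothing. *)
have [K0|/set0P K0] := eqVneq (K m) set0.
  rewrite K0 /pr preimage_set0 measure0/= powR0 ?mul0r ?gt_eqF//.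
  exact: pr_ge0.
have [L0|/set0P L0] := eqVneq (L m) set0.
  rewrite L0 /pr preimage_set0 measure0/= powR0 ?mulr0 ?pr_ge0//.
  by rewrite subr_eq0 gt_eqF.
have scK : sigma_compact (K m) by apply: compact_sigma_compact.
have scL : sigma_compact (L m) by apply: compact_sigma_compact.
have l01 : 0 <= l <= 1 by rewrite !ltW.
have := lcX (cK m) (cL m) K0 L0 l01.
rewrite /vector_law -!pr_fineK//; last exact: sigma_compact_set_conv.
rewrite !poweR_EFin -EFinM lee_fin => /le_trans; apply.
apply: le_pr; [exact: sigma_compact_set_conv..|].
move=> _ [x Kx [y Ly <-]]; exists x; first by rewrite FE; exists m.
by exists y => //; rewrite GE; exists m.
Unshelve. all: by end_near. Qed.

(** * Cells and Borell's lemma *)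

Definition cell A : Prop :=
  sigma_compact A /\
  forall x y l, 0 < l < 1 -> A x -> A y -> A (l *: x + (1 - l) *: y).

Definition affine (v : 'rV[R]_n) (c : R) (x : 'rV[R]_n) : R :=
  \sum_(i < n) v 0 i * x 0 i - c.

Lemma continuous_affine v c : continuous (affine v c).
Proof.
rewrite (_ : affine v c =
  (fun z => z - c) \o (fun x : 'rV[R]_n => \sum_(i < n) v 0 i * x 0 i))//.
move=> x; apply: continuous_comp; last first.
  by apply: cvgB; [exact: cvg_id|exact: cvg_cst].
move: x; apply: (@continuous_big _ _ +%R) => [|i _].
  exact: add_continuous.
rewrite (_ : (fun x => _) = ( *%R (v 0 i)) \o (fun x : 'rV[R]_n => x 0 i))//.
move=> x; apply: continuous_comp; first exact: coord_continuous.
exact: mulrl_continuous.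
Qed.

Lemma affine_conv v c x y l :
  affine v c (l *: x + (1 - l) *: y) = l * affine v c x + (1 - l) * affine v c y.
Proof.
rewrite /affine.
have -> : \sum_(i < n) v 0 i * (l *: x + (1 - l) *: y) 0 i =
    l * \sum_(i < n) v 0 i * x 0 i + (1 - l) * \sum_(i < n) v 0 i * y 0 i.
  rewrite !mulr_sumr -big_split/=; apply: eq_bigr => i _.
  by rewrite !mxE; ring.
ring.
Qed.

Lemma measurable_affine v c : measurable_fun setT (fun w => affine v c (V w)).
Proof.
apply: measurable_funB => //; apply: measurable_sum => i.
apply: measurable_funM => //.
rewrite (_ : (fun w => _) = X i); first exact: measurable_funPT.
by apply/funext => w; rewrite mxE.
Qed.

Lemma cellT : cell setT.
Proof. by split => //; apply: closed_sigma_compact; exact: closedT. Qed.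

Lemma cellI A B : cell A -> cell B -> cell (A `&` B).
Proof.
move=> [sA cA] [sB cB]; split; first exact: sigma_compactI.
by move=> x y l l01 [Ax Bx] [Ay By]; split; [exact: cA|exact: cB].
Qed.

Lemma cell_affine_lt v c a : cell [set x | affine v c x < a].
Proof.
split; first exact/sigma_compact_lt/continuous_affine.
by move=> x y l /andP[l0 l1] /= xa ya; rewrite affine_conv; nra.
Qed.

Lemma cell_affine_le v c a : cell [set x | affine v c x <= a].
Proof.
split.
  apply: closed_sigma_compact.
  apply: (@preimage_closed _ _ (affine v c) [set z : R | z <= a]).
    by move=> x _; exact: continuous_affine.
  exact: closed_le.
by move=> x y l /andP[l0 l1] /= xa ya; rewrite affine_conv; nra.
Qed.

Lemma cell_affine_ge v c a : cell [set x | a <= affine v c x].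
Proof.
split.
  apply: closed_sigma_compact.
  apply: (@preimage_closed _ _ (affine v c) [set z : R | a <= z]).
    by move=> x _; exact: continuous_affine.
  exact: closed_ge.
by move=> x y l /andP[l0 l1] /= xa ya; rewrite affine_conv; nra.
Qed.

Lemma cell_affine_gt v c a : cell [set x | a < affine v c x].
Proof.
rewrite (_ : [set x | _] = [set x | affine (- v) (- c) x < - a]).
  exact: cell_affine_lt.
apply/seteqP; split => x /=; rewrite /affine;
  (under [in X in _ -> X]eq_bigr do rewrite mxE mulNr) ||
  (under eq_bigr do rewrite mxE mulNr); rewrite sumrN; lra.
Qed.

Definition tail A v c (a : R) : set 'rV[R]_n := A `&` [set x | a <= `|affine v c x|].

Lemma continuous_norm_affine v c : continuous (fun x => `|affine v c x|).
Proof.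
rewrite (_ : (fun x => _) = (fun z : R => `|z|) \o affine v c)//.
move=> x; apply: continuous_comp; first exact: continuous_affine.
exact: norm_continuous.
Qed.

Lemma sigma_compact_tail A v c a : sigma_compact A -> sigma_compact (tail A v c a).
Proof.
move=> sA; apply: sigma_compactI => //; apply: closed_sigma_compact.
apply: (@preimage_closed _ _ (fun x => `|affine v c x|) [set z : R | a <= z]).
  by move=> x _; exact: continuous_norm_affine.
exact: closed_ge.
Qed.

Lemma prU A B C : sigma_compact A -> sigma_compact B -> sigma_compact C ->
  B `|` C = A -> B `&` C = set0 -> pr A = pr B + pr C.
Proof.
move=> sA sB sC BC BC0; apply: EFin_inj; rewrite EFinD !pr_fineK//.
rewrite -BC preimage_setU; apply: measureU.
- exact: sigma_compact_measurable.
- exact: sigma_compact_measurable.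
- by rewrite -preimage_setI BC0 preimage_set0.
Qed.

(* Borell's lemma: [tail A v c a] contains a convex combination of
   [tail A v c (y * a)] and of the complement of [tail A v c a]. *)
Lemma pr_tail_le A v c a (p y : R) : cell A -> 0 < a -> 1 <= p -> 1 <= y ->
  pr (tail A v c a) <= expR (- p) * pr A ->
  pr (tail A v c (y * a)) <= expR (- (p * (y - 1) / 4)) * pr A.
Proof.
move=> [sA cA] a0 p1 y1 tA.
have tails b : pr (tail A v c b) <= pr A.
  by apply: le_pr => //; [exact: sigma_compact_tail|move=> x []].
have [y1'|/negPf y1'] := eqVneq y 1.
  rewrite y1' mul1r subrr mulr0 mul0r oppr0 expR0 mul1r; exact: tails.
have {y1 y1'} y1 : 1 < y by rewrite lt_neqAle y1 eq_sym y1'.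
have [A0|A0] := eqVneq (pr A) 0.
  by rewrite A0 mulr0 -A0.
have {A0} A0 : 0 < pr A by rewrite lt_neqAle eq_sym A0 pr_ge0.
have [F0|F0] := eqVneq (pr (tail A v c (y * a))) 0.
  by rewrite F0 mulr_ge0 ?expR_ge0 ?pr_ge0.
have {F0} F0 : 0 < pr (tail A v c (y * a)) by rewrite lt_neqAle eq_sym F0 pr_ge0.
pose G := A `&` [set x | `|affine v c x| < a].
have sG : sigma_compact G.
  by apply: sigma_compactI => //; apply: sigma_compact_lt; exact: continuous_norm_affine.
have GE : pr A = pr (tail A v c a) + pr G.
  apply: prU => //; first exact: sigma_compact_tail.
    apply/seteqP; split => [x [[]//|[]//]|x Ax].
    by have [h|h] := leP a `|affine v c x|; [left|right].
  by apply/seteqP; split => // x [[_ /= h] [_ /=]]; rewrite ltNge h.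
have e1 := expR_half_bound p1.
(* By [expR_half_bound], [1 - expR (- p)] is at least [expR (- (p / 2))]. *)
have Glow : expR (- (p / 2)) * pr A <= pr G by nra.
(* The weight solves [l * (y * a) - (1 - l) * a = a], which puts the convex combinations outside the
   open slab of half-width [a]. *)
pose l := 2 / (y + 1).
have l0 : 0 < l by rewrite /l divr_gt0//; lra.
have l1 : l < 1 by rewrite /l ltr_pdivrMr; lra.
have ly : l * (y + 1) = 2 by rewrite /l divfK//; apply/negP => /eqP; lra.
have := log_concave_sigma_compact (F := tail A v c (y * a)) (G := G) (l := l).
rewrite l0 l1 => /(_ isT (sigma_compact_tail _ _ _ sA) sG) LC.
have {}LC : pr (tail A v c (y * a)) `^ l * pr G `^ (1 - l) <= expR (- p) * pr A.
  apply: (le_trans LC); apply: le_trans tA; apply: le_pr.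
  - by apply: sigma_compact_set_conv => //; exact: sigma_compact_tail.
  - exact: sigma_compact_tail.
  move=> _ [x [Ax /= xa] [z [Az /= za] <-]]; split.
    by apply: cA => //; rewrite l0.
  rewrite /= affine_conv.
  have h1 : l * `|affine v c x| - (1 - l) * `|affine v c z| <=
      `|l * affine v c x + (1 - l) * affine v c z|.
    rewrite -{1}(gtr0_norm l0) -normrM.
    rewrite -{1}(gtr0_norm (_ : 0 < 1 - l)) ?subr_gt0// -normrM.
    exact: lerB_normD.
  apply: le_trans h1; nra.
have L1 : ln (pr (tail A v c (y * a))) * l + ln (pr G) * (1 - l) <= - p + ln (pr A).
  have G0 : 0 < pr G by apply: lt_le_trans Glow; rewrite mulr_gt0// expR_gt0.
  rewrite -(ler_expR) expRD (expRD (- p)) (lnK (_ : _ \is Num.pos)) ?posrE//.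
  move: LC; rewrite /powR !gt_eqF//.
  by rewrite [l * _]mulrC [(1 - l) * _]mulrC.
have L2 : - (p / 2) + ln (pr A) <= ln (pr G).
  rewrite -[- (p / 2)]expRK -lnM ?posrE ?expR_gt0//.
  by rewrite ler_ln ?posrE//; [rewrite mulr_gt0// expR_gt0|
    apply: lt_le_trans Glow; rewrite mulr_gt0// expR_gt0].
have L3 : ln (pr (tail A v c (y * a))) <= - (p * (y - 1) / 4) + ln (pr A).
  rewrite -(ler_pM2l l0).
  have : (1 - l) * (- (p / 2) + ln (pr A)) <= (1 - l) * ln (pr G).
    by rewrite ler_wpM2l// subr_ge0 ltW.
  have : l * (p * (y - 1) / 4) = p / 2 - l * (p / 2).
    have -> : l * (p * (y - 1) / 4) = p / 4 * (l * (y + 1)) - l * (p / 2) by lra.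
    by rewrite ly; lra.
  have : 0 < l * p by rewrite mulr_gt0//; lra.
  lra.
rewrite -(lnK (_ : pr (tail A v c (y * a)) \is Num.pos)) ?posrE//.
rewrite -(lnK (_ : pr A \is Num.pos)) ?posrE// -expRD ler_expR//.
Qed.

Lemma integral_cst_pr A b : sigma_compact A ->
  (\int[P]_(w in V @^-1` A) b%:E = (b * pr A)%:E)%E.
Proof.
move=> sA; rewrite integral_cst; last exact: sigma_compact_measurable.
by rewrite EFinM pr_fineK.
Qed.

(** On the layer between [k * a] and [(k + 1) * a] the integrand is at most
    [expR (p * (k + 1) / 8)], whereas for [k >= 1] the mass is at most
    [expR (- (p * (k - 1) / 4)) * pr A] by [pr_tail_le]. The products decay geometrically. *)
Lemma integral_expR_affine_le A v c a (p : R) : cell A -> 0 < a -> 1 <= p ->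
  pr (tail A v c a) <= expR (- p) * pr A ->
  (\int[P]_(w in V @^-1` A) (expR (p * `|affine v c (V w)| / (8 * a)))%:E <=
    (9 * expR p * pr A)%:E)%E.
Proof.
move=> cA a0 p1 tA; have [sA _] := cA.
pose E k := V @^-1` [set x | k%:R * a <= `|affine v c x|].
have mE k : measurable (E k).
  apply: sigma_compact_measurable; rewrite -[X in sigma_compact X]setTI.
  by apply: sigma_compact_tail; case: cellT.
have mf : measurable_fun setT (fun w => affine v c (V w)) by exact: measurable_affine.
pose g w := expR (p * `|affine v c (V w)| / (8 * a)).
pose ck (k : nat) := expR (p * k.+1%:R / 8).
have := @integral_layers_le R disp T P (V @^-1` A) E g (cst 1%E) ck
  (sigma_compact_measurable sA) mE.
under eq_integral do rewrite mule1.
move=> /(_ _ _ _ _ _ _)/le_trans; apply.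
- apply: measurable_funTS; apply: measurableT_comp => //.
  by apply: measurable_funM => //; apply: measurable_funM => //; exact: measurableT_comp.
- by move=> w; exact: expR_ge0.
- by [].
- by move=> w; exact: lee01.
- by move=> k; exact: expR_ge0.
- move=> w _; exists (Num.truncn (`|affine v c (V w)| / a)).
    by rewrite /E /= -ler_pdivlMr// truncn_le// divr_ge0// ltW.
  rewrite /g /ck ler_expR invfM [8^-1 * _]mulrC mulrA ler_pM2r//.
  by rewrite -mulrA ler_pM2l ?(lt_le_trans ltr01)// ltW// truncnS_gt.
have q1 : expR (- (p / 8)) <= 8 / 9.
  rewrite expRN -[leRHS]invrK lef_pV2 ?posrE ?expR_gt0//.
  by apply: le_trans (expR_ge1Dx _); lra.
(* The constant [expR (3 * p / 8)] makes the geometric bound match the product exactly for [k >= 1].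
   The final factor 9 is [1 / (1 - 8 / 9)]. *)
apply: le_trans (_ : (_ <= (expR (3 * p / 8) * pr A / (1 - expR (- (p / 8))))%:E)%E) _.
  apply: nneseries_geometric_le.
  - by rewrite mulr_ge0 ?expR_ge0 ?pr_ge0.
  - by rewrite expR_ge0/=; lra.
  - move=> k; apply: mule_ge0; rewrite ?lee_fin ?expR_ge0//.
    by apply: integral_ge0 => w _; exact: lee01.
  move=> k; rewrite -preimage_setI -/(tail A v c (k%:R * a)).
  rewrite integral_cst_pr ?mul1r; last exact: sigma_compact_tail.
  rewrite -EFinM lee_fin -expRM_natl /ck.
  case: k => [|k].
    rewrite !mul0r expR0 mulr1; apply: ler_pM; rewrite ?expR_ge0 ?pr_ge0//.
      by rewrite ler_expR; lra.
    by apply: le_pr => //; [exact: sigma_compact_tail|move=> x []].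
  have k1 : 1 <= k.+1%:R :> R by rewrite ler1n.
  have := pr_tail_le cA a0 p1 k1 tA.
  move=> /(ler_wpM2l (expR_ge0 (p * k.+2%:R / 8))) /le_trans; apply.
  rewrite mulrA -expRD [leRHS]mulrAC -expRD ler_wpM2r ?pr_ge0// ler_expR.
  by rewrite -[k.+2%:R]natr1; lra.
rewrite lee_fin mulrAC ler_wpM2r ?pr_ge0// mulrC.
apply: ler_pM; rewrite ?invr_ge0 ?expR_ge0//; first lra.
  by rewrite -[leRHS]invrK lef_pV2 ?posrE; lra.
by rewrite ler_expR; lra.
Qed.

(** This is the starting point of Borell's lemma on the whole space. It provides every affine
    functional with some exponential moment, and so all the integrability needed below. *)
Lemma small_tail v c : exists2 a, 0 < a &
  pr (tail setT v c a) <= expR (- 1) * pr setT.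
Proof.
have [sT _] := cellT.
have prT : pr setT = 1 by rewrite /pr preimage_setT probability_setT.
pose F (m : nat) := [set x : 'rV[R]_n | `|affine v c x| < m%:R].
have sF m : sigma_compact (F m).
  by apply: sigma_compact_lt; exact: continuous_norm_affine.
have FT : \bigcup_m (V @^-1` F m) = setT.
  rewrite -subTset => w _; exists (Num.truncn `|affine v c (V w)|).+1 => //.
  exact: truncnS_gt.
have : P (V @^-1` F m) @[m --> \oo] --> P (\bigcup_m (V @^-1` F m)).
  apply: nondecreasing_cvg_mu => //.
  - by move=> m; exact: sigma_compact_measurable.
  - by rewrite FT.
  - move=> m m' mm'; apply/subsetPset => w /lt_le_trans; apply.
    by rewrite ler_nat.
rewrite FT probability_setT => h.
have : fine (P (V @^-1` F m)) @[m --> \oo] --> (1 : R) by exact: fine_cvg h.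
move=> /cvgr_gt /(_ (1 - expR (- 1))).
have e0 := expR_gt0 (- 1 : R).
rewrite ltrBlDr ltrDl => /(_ e0) [m _ /(_ m (leqnn m)) mlt].
exists m.+1%:R => //; rewrite prT mulr1.
have TE : pr setT = pr (tail setT v c m%:R) + pr (F m).
  apply: prU => //; first exact: sigma_compact_tail.
    apply/seteqP; split => // x _.
    by have [h'|h'] := leP m%:R `|affine v c x|; [left|right].
  by apply/seteqP; split => // x [[_ /= h1] /=]; rewrite /F/= ltNge h1.
apply: (@le_trans _ _ (pr (tail setT v c m%:R))).
  apply: le_pr; [exact: sigma_compact_tail|exact: sigma_compact_tail|].
  by move=> x [_ /= h1]; split => //=; apply: le_trans h1; rewrite ler_nat.
have mlt' : 1 - expR (- 1) < pr (F m) by exact: mlt.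
lra.
Qed.

Lemma exp_moment_affine v c : exists2 t, 0 < t &
  (\int[P]_w (expR (t * `|affine v c (V w)|))%:E < +oo)%E.
Proof.
have [a a0 ta] := small_tail v c.
exists (8 * a)^-1; first by rewrite invr_gt0 mulr_gt0.
have := integral_expR_affine_le cellT a0 (lexx 1) ta.
rewrite preimage_setT; under eq_integral do rewrite mul1r mulrC.
by move=> /le_lt_trans; apply; rewrite ltry.
Qed.

Lemma integrable_le_expR v c (f : T -> R) (C t : R) :
  measurable_fun setT f -> 0 <= C ->
  (\int[P]_w (expR (t * `|affine v c (V w)|))%:E < +oo)%E ->
  (forall w, `|f w| <= C * expR (t * `|affine v c (V w)|)) ->
  P.-integrable setT (EFin \o f).
Proof.
move=> mf C0 h fle; apply/integrableP; split; first exact/measurable_EFinP.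
have me : measurable_fun setT (fun w => expR (t * `|affine v c (V w)|)).
  apply: measurableT_comp => //; apply: measurable_funM => //.
  by apply: measurableT_comp => //; exact: measurable_affine.
apply: (@le_lt_trans _ _ (\int[P]_w (C%:E * (expR (t * `|affine v c (V w)|))%:E))%E).
  apply: ge0_le_integral => //.
  - by apply: measurableT_comp => //; exact/measurable_EFinP.
  - by apply: measurable_funeM; exact/measurable_EFinP.
  - by move=> w _; rewrite -EFinM lee_fin; exact: fle.
rewrite ge0_integralZl_EFin//.
- by rewrite lte_mul_pinfty.

- exact/measurable_EFinP.
Qed.

Lemma integrable_powR_affine v c (q : R) : 0 < q ->
  P.-integrable setT (EFin \o (fun w => `|affine v c (V w)| `^ q)).
Proof.
move=> q0; have [t t0 h] := exp_moment_affine v c.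
apply: (@integrable_le_expR v c _ ((q / t) `^ q) t) => //.
- apply: (measurableT_comp (f := fun x => x `^ q)) => //.
  by apply: measurableT_comp => //; exact: measurable_affine.
- exact: powR_ge0.
- by move=> w; rewrite ger0_norm ?powR_ge0//; exact: powR_le_expR.
Qed.

Lemma integrable_affine v c :
  P.-integrable setT (EFin \o (fun w => affine v c (V w))).
Proof.
have [t t0 h] := exp_moment_affine v c.
apply: (@integrable_le_expR v c _ (1 / t) t) => //.
- exact: measurable_affine.
- by rewrite divr_ge0// ltW.
- move=> w; have := powR_le_expR ltr01 t0 (normr_ge0 (affine v c (V w))).
  by rewrite !powRr1// divr_ge0// ltW.
Qed.

(** * Integrals over cells *)

Local Notation "'J[' A ] f" := (Rintegral P (V @^-1` A) f)
  (at level 36, f at level 36, format "'J[' A ]  f") : ring_scope.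

Lemma integrable_pre A (f : T -> R) : sigma_compact A ->
  P.-integrable setT (EFin \o f) -> P.-integrable (V @^-1` A) (EFin \o f).
Proof.
move=> sA; apply: integrableS => //; exact: sigma_compact_measurable.
Qed.

Lemma JE A (f : T -> R) : sigma_compact A ->
  P.-integrable setT (EFin \o f) ->
  (J[A] f)%:E = (\int[P]_(w in V @^-1` A) (f w)%:E)%E.
Proof.
move=> sA /(integrable_pre sA) fi; rewrite /Rintegral fineK//.
by apply: integrable_fin_num => //; exact: sigma_compact_measurable.
Qed.

Lemma integrable_norm_affine v c :
  P.-integrable setT (EFin \o (fun w => `|affine v c (V w)|)).
Proof.
have := integrable_powR_affine v c ltr01; congr (P.-integrable _ _).
by apply/funext => w /=; rewrite powRr1.
Qed.

Lemma integrable_sqr_affine v c :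
  P.-integrable setT (EFin \o (fun w => affine v c (V w) ^+ 2)).
Proof.
have := @integrable_powR_affine v c 2%:R (ltr0n R 2); congr (P.-integrable _ _).
by apply/funext => w /=; rewrite powR_mulrn// real_normK// num_real.
Qed.

Lemma integrable_realZ b (f : T -> R) : P.-integrable setT (EFin \o f) ->
  P.-integrable setT (EFin \o (fun w => b * f w)).
Proof.
move=> fi; rewrite (_ : _ \o _ = (fun w => b%:E * (EFin \o f) w)%E); last first.
  by apply/funext => w; rewrite /= EFinM.
exact: integrableZl.
Qed.

Lemma integrable_realD (f g : T -> R) :
  P.-integrable setT (EFin \o f) -> P.-integrable setT (EFin \o g) ->
  P.-integrable setT (EFin \o (fun w => f w + g w)).
Proof.
move=> fi gi; rewrite (_ : _ \o _ = ((EFin \o f) \+ (EFin \o g))%E); last first.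
  by apply/funext => w; rewrite /= EFinD.
exact: integrableD.
Qed.

Lemma integrable_cst b : P.-integrable setT (EFin \o (fun _ : T => b)).
Proof. exact: finite_measure_integrable_cst. Qed.

Lemma J_cst A b : sigma_compact A -> J[A] (fun=> b) = b * pr A.
Proof. by move=> /sigma_compact_measurable mA; rewrite Rintegral_cst. Qed.

Lemma J_le A (f g : T -> R) : sigma_compact A ->
  P.-integrable setT (EFin \o f) -> P.-integrable setT (EFin \o g) ->
  (forall w, A (V w) -> f w <= g w) -> J[A] f <= J[A] g.
Proof.
move=> sA fi gi fg; apply: le_Rintegral => //; try exact: integrable_pre.
exact: sigma_compact_measurable.
Qed.

Lemma JD A (f g : T -> R) : sigma_compact A ->
  P.-integrable setT (EFin \o f) -> P.-integrable setT (EFin \o g) ->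
  J[A] (fun w => f w + g w) = J[A] f + J[A] g.
Proof.
move=> sA fi gi; apply: RintegralD; try exact: integrable_pre.
exact: sigma_compact_measurable.
Qed.

Lemma JZ A (f : T -> R) b : sigma_compact A ->
  P.-integrable setT (EFin \o f) -> J[A] (fun w => b * f w) = b * J[A] f.
Proof.
move=> sA fi; apply: RintegralZl; last exact: integrable_pre.
exact: sigma_compact_measurable.
Qed.

Lemma markov_affine A v c a : sigma_compact A -> 0 < a ->
  a * pr (tail A v c a) <= J[A] (fun w => `|affine v c (V w)|).
Proof.
move=> sA a0; rewrite -lee_fin JE//; last exact: integrable_norm_affine.
have mA := sigma_compact_measurable sA.
have := @le_integral_abse _ T R P (V @^-1` A) mA
  (fun w => (affine v c (V w))%:E) a _ a0.
rewrite EFinM pr_fineK; last exact: sigma_compact_tail.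
by apply; apply/measurable_EFinP; apply: measurable_funTS; exact: measurable_affine.
Qed.

(** The numerical constants are [locked] so that arithmetic tactics treat them as atoms. *)
Definition C_sqr : R := locked (384 ^+ 2).

Lemma C_sqr_ge1 : 1 <= C_sqr.
Proof.
have h (x : R) : 1 <= x -> 1 <= x ^+ 2 by move=> x1; rewrite exprn_ege1.
by rewrite /C_sqr -lock; apply: h; rewrite ler1n.
Qed.

Lemma C_sqr_gt0 : 0 < C_sqr.
Proof. exact: lt_le_trans C_sqr_ge1. Qed.

(** A reverse Hoelder inequality: by Markov the tail beyond [4 * s] carries at most a quarter of the
    mass, which is below [expR (- 1)]. Borell's lemma then gives an exponential moment at the scale
    [s], which dominates the square. *)
Lemma sqr_moment_le A v c (s : R) : cell A -> 0 < s ->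
  J[A] (fun w => `|affine v c (V w)|) <= s * pr A ->
  J[A] (fun w => affine v c (V w) ^+ 2) <= C_sqr * s ^+ 2 * pr A.
Proof.
move=> cA s0 h; have [sA _] := cA.
have a0 : 0 < 4 * s by rewrite mulr_gt0.
have ta : pr (tail A v c (4 * s)) <= expR (- 1) * pr A.
  have := markov_affine v c sA a0; have := expRN1_ge R; have := pr_ge0 A.
  move=> A0 e1 h1.
  have : pr (tail A v c (4 * s)) <= pr A / 4.
    by rewrite -(ler_pM2l a0); apply: (le_trans h1); apply: (le_trans h); lra.
  by nra.
have h2 := integral_expR_affine_le cA a0 (lexx 1) ta.
rewrite -lee_fin JE//; last exact: integrable_sqr_affine.
have mA := sigma_compact_measurable sA.
have maf : measurable_fun (V @^-1` A) (fun w => affine v c (V w)).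
  by apply: measurable_funTS; exact: measurable_affine.
have me : measurable_fun (V @^-1` A)
    (fun w => expR (1 * `|affine v c (V w)| / (8 * (4 * s)))).
  apply: measurableT_comp => //; apply: measurable_funM => //.
  by apply: measurable_funM => //; exact: measurableT_comp.
apply: (@le_trans _ _ (\int[P]_(w in V @^-1` A) ((4 * (32 * s) ^+ 2)%:E *
    (expR (1 * `|affine v c (V w)| / (8 * (4 * s))))%:E))%E).
  apply: ge0_le_integral => //.
  - by move=> w _; rewrite lee_fin sqr_ge0.
  - by apply/measurable_EFinP; exact: measurable_funX.
  - by apply: measurable_funeM; exact/measurable_EFinP.
  - move=> w _; rewrite -EFinM lee_fin mul1r.
    have -> : 8 * (4 * s) = 32 * s by ring.
    have x0 : 0 <= `|affine v c (V w)| / (32 * s).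
      by rewrite divr_ge0// ltW// mulr_gt0.
    have := sqr_le_expR x0; rewrite expr_div_n real_normK ?num_real//.
    rewrite ler_pdivrMr; last by rewrite exprn_gt0// mulr_gt0.
    by move=> /le_trans; apply; rewrite le_eqVlt; apply/orP; left; apply/eqP; ring.
rewrite ge0_integralZl_EFin//.
- apply: le_trans (lee_wpmul2l _ h2) _; first by rewrite lee_fin mulr_ge0// sqr_ge0.
  rewrite -EFinM lee_fin !mulrA ler_wpM2r ?pr_ge0// /C_sqr -lock.
  (* [C_sqr] equals [4 * 32 * 32 * 9 * 4], the last factor bounding [expR 1]. *)
  rewrite [leLHS](_ : _ = 4 * 32 * 32 * 9 * (s * s) * expR 1); last by ring.
  rewrite [leRHS](_ : _ = 4 * 32 * 32 * 9 * (s * s) * 4); last by ring.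
  by rewrite ler_wpM2l ?expR1_le4// !mulr_ge0// ltW.
- exact/measurable_EFinP.
- by rewrite mulr_ge0// sqr_ge0.
Qed.

(* Paley-Zygmund for the positive part of a centred functional, whose integral
   is half of that of the absolute value. *)
Lemma pr_gt_mean A v m (s : R) : cell A -> 0 < s ->
  J[A] (fun w => affine v m (V w)) = 0 ->
  J[A] (fun w => `|affine v m (V w)|) = s * pr A ->
  pr A <= 32 * C_sqr * pr (A `&` [set x | s / 8 < affine v m x]).
Proof.
move=> cA s0 h0 h1; have [sA _] := cA.
set B := _ `&` _.
have sB : sigma_compact B by apply: sigma_compactI => //; case: (cell_affine_gt v m (s / 8)).
have C0 := C_sqr_gt0.
have [Th Th0 ThE] : exists2 Th : R, 0 < Th & Th = 8 * C_sqr.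
  by exists (8 * C_sqr) => //; rewrite mulr_gt0.
have mB := sigma_compact_measurable sB.
have iB : P.-integrable setT (EFin \o (\1_(V @^-1` B) : T -> R)).
  exact: integrable_indic.
have i1 := integrable_affine v m.
have i2 := integrable_norm_affine v m.
have i3 := integrable_sqr_affine v m.
(* Off [B] twice the positive part is at most [s / 4]; on [B] it is bounded by a constant plus a
   multiple of the square. With [Th = 8 * C_sqr] the square also contributes at most [s / 4 * pr A],
   so that half of [s * pr A] is left for [B]. *)
have key : J[A] (fun w => affine v m (V w) + `|affine v m (V w)|) <=
    J[A] (fun w => s / 4 + (2 * Th * s * \1_(V @^-1` B) w +
       2 / (Th * s) * affine v m (V w) ^+ 2)).
  apply: J_le => //.
  - exact: integrable_realD.
  - by apply: integrable_realD; [exact: integrable_cst|apply: integrable_realD; exact: integrable_realZ].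
  - move=> w Aw; set z := affine v m (V w).
    have z2 : 0 <= 2 / (Th * s) * z ^+ 2.
      by apply: mulr_ge0; rewrite ?sqr_ge0// divr_ge0// ltW// mulr_gt0.
    have [zs|zs] := ltP (s / 8) z; last first.
      have : 0 <= 2 * Th * s * \1_(V @^-1` B) w.
        by rewrite mulr_ge0// ltW// !mulr_gt0.
      have : z + `|z| <= s / 4 by have [|] := ger0P z; lra.
      lra.
    rewrite indicE mem_set//= mulr1.
    have z0 : 0 < z by apply: lt_trans zs; rewrite divr_gt0.
    rewrite gtr0_norm//.
    have : 2 * z <= 2 * Th * s + 2 / (Th * s) * z ^+ 2.
      have Ths : 0 < Th * s by rewrite mulr_gt0.
      rewrite -(ler_pM2l Ths) [leRHS]mulrDr.
      have -> : Th * s * (2 / (Th * s) * z ^+ 2) = 2 * z ^+ 2.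
        by field; rewrite !gt_eqF.
      by nra.
    lra.
have JB : J[A] (\1_(V @^-1` B)) = pr B.
  rewrite /Rintegral integral_indic//; last exact: sigma_compact_measurable.
  by rewrite /pr setIidl// => w [].
rewrite JD// h0 h1 add0r in key.
rewrite JD// in key; last 2 first.
- exact: integrable_cst.
- by apply: integrable_realD; exact: integrable_realZ.
rewrite J_cst// in key.
rewrite JD// in key; try exact: integrable_realZ.
rewrite !JZ// JB in key.
have h3 : J[A] (fun w => affine v m (V w) ^+ 2) <= C_sqr * s ^+ 2 * pr A.
  by apply: sqr_moment_le => //; rewrite h1.
have h4 : 2 / (Th * s) * J[A] (fun w => affine v m (V w) ^+ 2) <= s / 4 * pr A.
  apply: (@le_trans _ _ (2 / (Th * s) * (C_sqr * s ^+ 2 * pr A))).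
    by rewrite ler_wpM2l// divr_ge0// ltW// mulr_gt0.
  by rewrite le_eqVlt; apply/orP; left; apply/eqP; rewrite ThE; field; rewrite !gt_eqF.
rewrite -(ler_pM2l s0).
have : s * pr A <= s / 4 * pr A + (2 * (8 * C_sqr) * s * pr B + s / 4 * pr A).
  by rewrite -ThE; lra.
lra.
Qed.

(** * Decomposition of a cell into leaves *)

Section Tree.
Context (d : 'I_n -> R) (l K G delta : R).

Definition coord (i : 'I_n) (c : R) := affine (delta_mx 0 i) c.

Lemma coordE i c (x : 'rV[R]_n) : coord i c x = x 0 i - c.
Proof.
rewrite /coord /affine (bigD1 i)//= mxE !eqxx mul1r big1 ?addr0// => j ji.
by rewrite mxE (negbTE ji) andbF mul0r.
Qed.

Definition node : Type := ('I_n * R * R * option bool)%type.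

Definition side (s : node) : set 'rV[R]_n :=
  let: (i, a, b, c) := s in
  match c with
  | Some false => [set x | coord i 0 x < a]
  | None => [set x | a <= coord i 0 x] `&` [set x | coord i 0 x <= b]
  | Some true => [set x | b < coord i 0 x]
  end.

Lemma cell_side s : cell (side s).
Proof.
move: s => [[[i a] b] [[]|]]; rewrite /side.
- exact: cell_affine_gt.
- exact: cell_affine_lt.
- by apply: cellI; [exact: cell_affine_ge|exact: cell_affine_le].
Qed.

Implicit Types p q : seq node.

Fixpoint descend (A : set 'rV[R]_n) p : set 'rV[R]_n :=
  if p is s :: p' then descend (A `&` side s) p' else A.

Lemma cell_descend A p : cell A -> cell (descend A p).
Proof.
elim: p A => //= s p ih A cA; apply: ih; apply: cellI => //; exact: cell_side.
Qed.

Lemma descend_sub A p : descend A p `<=` A.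
Proof. by elim: p A => [A x|s p ih A x /= /ih[]]. Qed.

Lemma descend_side A p x : descend A p x -> forall s, s \in p -> side s x.
Proof.
elim: p A => //= s p ih A h t; rewrite in_cons => /predU1P[->|tp].
  by have [] := @descend_sub (A `&` side s) p x h.
exact: ih h _ tp.
Qed.

Definition spread (A : set 'rV[R]_n) : Prop :=
  exists i a b, [/\ 0 < d i, G * d i < b - a,
    delta * pr A <= pr (A `&` [set x | coord i 0 x < a]) &
    delta * pr A <= pr (A `&` [set x | b < coord i 0 x])].

(* [consistent s x] is necessary for [x] to be [l *: y + (1 - l) *: z] with [y]
   in [side s] and [z] within [K * d i] of the origin in the coordinate of
   [s]. *)
Definition consistent (s : node) (x : 'rV[R]_n) : bool :=
  let: (i, a, b, c) := s in
  match c with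
  | Some false => x 0 i <= l * a + K * d i
  | None => true
  | Some true => l * b - K * d i <= x 0 i
  end.

(** An inconsistency costs [2^-1] and not 0: a typical point [z] may leave the range [K * d i] in
    some coordinates of the branch, and the product of the factors must stay positive there. *)
Definition factor s x : R := if consistent s x then 1 else 2^-1.

Definition weight p x : R := \prod_(s <- p) factor s x.

Lemma factor_ge0 s x : 0 <= factor s x.
Proof. by rewrite /factor; case: ifP => _; rewrite ?invr_ge0. Qed.

Lemma weight_ge0 p x : 0 <= weight p x.
Proof. by rewrite /weight prodr_ge0// => s _; exact: factor_ge0. Qed.

Definition children i (a b : R) : seq node :=
  [:: (i, a, b, Some false); (i, a, b, None); (i, a, b, Some true)].

Lemma J_children A i (a b : R) (f : T -> R) : a <= b -> sigma_compact A ->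
  P.-integrable setT (EFin \o f) ->
  J[A] f = J[A `&` side (i, a, b, Some false)] f +
           J[A `&` side (i, a, b, None)] f + J[A `&` side (i, a, b, Some true)] f.
Proof.
move=> ab sA fi.
have sS s : sigma_compact (A `&` side s).
  by apply: sigma_compactI => //; have [] := cell_side s.
have mS s := sigma_compact_measurable (sS s).
have dS s1 s2 : side s1 `&` side s2 = set0 ->
    [disjoint V @^-1` (A `&` side s1) & V @^-1` (A `&` side s2)].
  move=> s12; apply/disj_setPS => w [[_ w1] [_ w2]].
  by have : (side s1 `&` side s2) (V w) by []; rewrite s12.
have AE : V @^-1` A = V @^-1` (A `&` side (i, a, b, Some false)) `|`
    V @^-1` (A `&` side (i, a, b, None)) `|` V @^-1` (A `&` side (i, a, b, Some true)).
  apply/seteqP; split => [w Aw|w [[[]|[]]|[]]]//.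
  have [h1|h1] := ltP (coord i 0 (V w)) a; first by left; left.
  have [h2|h2] := leP (coord i 0 (V w)) b; first by left; right.
  by right.
have iS (S : set T) : measurable S -> P.-integrable S (EFin \o f).
  by move=> mS'; apply: integrableS fi.
rewrite AE Rintegral_setU//; first rewrite Rintegral_setU//.
- exact/iS/measurableU.
- apply: dS; apply/seteqP; split => // x [/= x1 [x2 x3]].
  by move: x1; rewrite ltNge x2.
- exact: measurableU.
- by apply: iS; apply: measurableU => //; exact: measurableU.
- apply/disj_setPS => w [[] [_ w1] [_ w2]]; move: w1 w2 => /=.
    by move=> /lt_le_trans/(_ ab)/ltW/le_lt_trans/[apply]; rewrite ltxx.
  by move=> [_ /le_lt_trans/[apply]]; rewrite ltxx.
Qed.

Lemma pr_J A : sigma_compact A -> pr A = J[A] (fun=> 1).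
Proof. by move=> sA; rewrite J_cst// mul1r. Qed.

Context (lG : 2 * K <= l * G) (l0 : 0 < l) (delta0 : 0 < delta <= 1).
Context (K0 : 0 <= K) (G0 : 0 <= G).

Let rho_ge0 : 0 <= 1 - delta / 2.
Proof. by move/andP: delta0 => [? ?]; lra. Qed.

(** No [x] is consistent with both outer slabs: this would give [l * (b - a) <= 2 * K * d i],
    against [2 * K <= l * G] and [G * d i < b - a]. Hence one outer slab, of mass at least
    [delta * pr A], is halved. *)
Lemma factor_children_le A i (a b : R) x : sigma_compact A ->
  0 < d i -> G * d i < b - a ->
  delta * pr A <= pr (A `&` side (i, a, b, Some false)) ->
  delta * pr A <= pr (A `&` side (i, a, b, Some true)) ->
  \sum_(s <- children i a b) factor s x * pr (A `&` side s) <=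
    (1 - delta / 2) * pr A.
Proof.
move=> sA di ab hlo hhi.
have ab' : a <= b by rewrite -subr_ge0 ltW// (le_lt_trans _ ab)// mulr_ge0// ltW.
have sS s : sigma_compact (A `&` side s).
  by apply: sigma_compactI => //; have [] := cell_side s.
have prE : pr A = pr (A `&` side (i, a, b, Some false)) +
    pr (A `&` side (i, a, b, None)) + pr (A `&` side (i, a, b, Some true)).
  by rewrite !pr_J//; apply: J_children => //; exact: integrable_cst.
rewrite /children !big_cons big_nil addr0.
rewrite {2}/factor [consistent (i, a, b, None) x]/= mul1r.
have : factor (i, a, b, Some false) x + factor (i, a, b, Some true) x <= 3 / 2.
  rewrite /factor /=; case: ifPn => [h1|_]; case: ifPn => [h2|_]; try lra.
  exfalso; have : l * (G * d i) < l * (b - a) by rewrite ltr_pM2l.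
  have : 2 * K * d i <= l * G * d i by rewrite ler_wpM2r// ltW.
  by lra.
have f1 s : factor s x <= 1 by rewrite /factor; case: ifP => _; lra.
have := f1 (i, a, b, Some false); have := f1 (i, a, b, Some true).
have : factor (i, a, b, Some false) x = 1 \/ factor (i, a, b, Some false) x = 2^-1.
  by rewrite /factor; case: ifP; [left|right].
have : factor (i, a, b, Some true) x = 1 \/ factor (i, a, b, Some true) x = 2^-1.
  by rewrite /factor; case: ifP; [left|right].
have := pr_ge0 (A `&` side (i, a, b, Some false)).
have := pr_ge0 (A `&` side (i, a, b, Some true)).
have := pr_ge0 (A `&` side (i, a, b, None)).
move: prE hlo hhi.
by move=> prE hlo hhi ? ? ? [->|->] [->|->]; lra.
Qed.

(** By induction on the depth, a spread cell is cut in three and any other cell becomes a leaf in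
    [GG]. [BB] collects the branches of full length [k], whose last cells are not examined. The
    identity for all integrable [f] expresses that the leaves partition [A]. In the last bound each
    level gains one factor from [factor_children_le], for every fixed [x]. *)
Lemma tree_decomposition k A : cell A ->
  exists GG BB : seq (seq node),
  [/\ forall p, p \in GG -> ~ spread (descend A p),
      forall p, p \in BB -> size p = k /\ (forall s, s \in p -> 0 < d s.1.1.1),
      forall f, P.-integrable setT (EFin \o f) ->
        J[A] f = \sum_(p <- GG) J[descend A p] f + \sum_(p <- BB) J[descend A p] f,
      (size GG + size BB <= 3 ^ k)%N &
      forall x, \sum_(p <- BB) pr (descend A p) * weight p x <=
        (1 - delta / 2) ^+ k * pr A].
Proof.
elim: k A => [|k ih] A cA.
  exists [::], [:: [::]]; split => //.
  - by move=> p; rewrite inE => /eqP ->.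
  - by move=> f fi; rewrite big_nil big_seq1 add0r.
  - by move=> x; rewrite big_seq1 /weight big_nil mulr1 expr0 mul1r.
have [sA _] := cA.
have [[i [a [b [di ab hlo hhi]]]]|nsA] := pselect (spread A); last first.
  exists [:: [::]], [::]; split => //.
  - by move=> p; rewrite inE => /eqP ->.
  - by move=> f fi; rewrite big_nil big_seq1 addr0.
  - by rewrite expn_gt0.
  - move=> x; rewrite big_nil mulr_ge0 ?pr_ge0// exprn_ge0//.
have cS s : cell (A `&` side s) by apply: cellI => //; exact: cell_side.
have /choice[GG /choice[BB GB]] := fun s => ih _ (cS s).
exists (flatten [seq [seq s :: p | p <- GG s] | s <- children i a b]),
  (flatten [seq [seq s :: p | p <- BB s] | s <- children i a b]).
have ab' : a <= b by rewrite -subr_ge0 ltW// (le_lt_trans _ ab)// mulr_ge0// ltW.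
split.
- move=> p /flatten_mapP[s _ /mapP[q qs ->]] /=.
  by have [h _ _ _ _] := GB s; exact: h.
- move=> p /flatten_mapP[s sc /mapP[q qs ->]] /=.
  have [_ h _ _ _] := GB s; have [-> hq] := h _ qs; split => // t.
  rewrite in_cons => /predU1P[->|/hq//].
  by move: sc; rewrite !inE => /or3P[] /eqP ->.
- move=> f fi; rewrite !big_flatten !big_map.
  rewrite (J_children i ab' sA fi) /children !big_cons !big_nil !big_map.
  have [_ _ /(_ _ fi) -> _ _] := GB (i, a, b, Some false).
  have [_ _ /(_ _ fi) -> _ _] := GB (i, a, b, None).
  have [_ _ /(_ _ fi) -> _ _] := GB (i, a, b, Some true).
  by rewrite /=; ring.
- rewrite !size_flatten /shape -!map_comp /= !size_map !addn0.
  have [_ _ _ h0 _] := GB (i, a, b, Some false).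
  have [_ _ _ h1 _] := GB (i, a, b, None).
  have [_ _ _ h2 _] := GB (i, a, b, Some true).
  apply: leq_trans (_ : (3 ^ k + (3 ^ k + 3 ^ k) <= 3 ^ k.+1)%N); last first.
    by rewrite expnS !mulSn mul0n addn0.
  rewrite addnACA; apply: leq_add => //.
  by rewrite addnACA; exact: leq_add.
- move=> x; rewrite big_flatten big_map.
  have := factor_children_le x sA di ab hlo hhi.
  move=> /(ler_wpM2l (exprn_ge0 k rho_ge0)).
  rewrite mulrA -exprSr; apply: le_trans.
  rewrite mulr_sumr; apply: ler_sum => s _; rewrite big_map /=.
  have [_ _ _ _ h] := GB s.
  have := h x => /(ler_wpM2l (factor_ge0 s x)).
  rewrite mulr_sumr mulrCA; apply: le_trans.
  apply: ler_sum => q _; rewrite /weight big_cons mulrCA.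
  by [].
Qed.

Context (l1 : l < 1) (K1 : 0 < K).
Context (d_sqr : forall i, J[setT] (fun w => coord i 0 (V w) ^+ 2) <= d i ^+ 2).

Definition dist2 p (z : 'rV[R]_n) : R :=
  \sum_(s <- p) (coord s.1.1.1 0 z / d s.1.1.1) ^+ 2.

(** If [z] is within [K * d i] of the origin in this coordinate, the combination is consistent with
    the cut. Otherwise the exponent is at most [- 1], and [expR (- 1) <= 2^-1]. *)
Lemma factor_conv_ge s (y z : 'rV[R]_n) : 0 < d s.1.1.1 -> side s y ->
  expR (- ((coord s.1.1.1 0 z / d s.1.1.1) ^+ 2 / K ^+ 2)) <=
  factor s (l *: y + (1 - l) *: z).
Proof.
move: s => [[[i a] b] c] /= di sy.
set e := (coord i 0 z / d i) ^+ 2 / K ^+ 2.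
have K2 : 0 < K ^+ 2 by rewrite exprn_gt0.
have e0 : 0 <= e by rewrite divr_ge0 ?sqr_ge0.
have ex1 : expR (- e) <= 1 by rewrite -expR0 ler_expR oppr_le0.
have [zK|zK] := leP `|coord i 0 z| (K * d i); last first.
  have e1 : 1 <= e.
    rewrite /e ler_pdivlMr// mul1r -[leRHS]real_normK ?num_real//.
    rewrite lerXn2r ?nnegrE ?normr_ge0//.
    by rewrite normrM normfV (gtr0_norm di) ler_pdivlMr// ltW.
  apply: (@le_trans _ _ 2^-1).
    apply: (@le_trans _ _ (expR (- 1))); first by rewrite ler_expR lerN2.
    rewrite expRN lef_pV2 ?posrE ?expR_gt0//.
    by have := expR_ge1Dx (1 : R); lra.
  by rewrite /factor; case: ifP => _; lra.
suff -> : factor (i, a, b, c) (l *: y + (1 - l) *: z) = 1 by [].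
have zl : `|(1 - l) * z 0 i| <= K * d i.
  rewrite normrM ger0_norm; last by rewrite subr_ge0 ltW.
  apply: le_trans zK; rewrite coordE subr0 ler_piMl//.
  by rewrite gerBl ltW.
rewrite /factor; case: ifP => // /negbT /negP []; move: zl; rewrite ler_norml => /andP[z1 z2].
case: c sy => [[]|]//=; rewrite !mxE coordE subr0 => yb.
- have : l * b <= l * y 0 i by rewrite ler_pM2l// ltW.
  lra.
- have : l * y 0 i <= l * a by rewrite ler_pM2l// ltW.
  lra.
Qed.

Lemma weight_conv_ge A p (y z : 'rV[R]_n) :
  (forall s, s \in p -> 0 < d s.1.1.1) -> descend A p y ->
  expR (- (dist2 p z / K ^+ 2)) <= weight p (l *: y + (1 - l) *: z).
Proof.
move=> dp /descend_side; move: dp; rewrite /dist2 /weight.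
elim: p => [|s p ih] dp sp.
  by rewrite !big_nil mul0r oppr0 expR0.
rewrite !big_cons mulrDl opprD expRD; apply: ler_pM; rewrite ?expR_ge0//.
  by apply: factor_conv_ge; [apply: dp|apply: sp]; rewrite mem_head.
by apply: ih => t tp; [apply: dp|apply: sp]; rewrite in_cons tp orbT.
Qed.

Lemma integrable_dist2 p :
  P.-integrable setT (EFin \o (fun w => dist2 p (V w))).
Proof.
rewrite /dist2; elim: p => [|s p ih].
  by under eq_fun do rewrite big_nil; exact: integrable_cst.
under eq_fun do rewrite big_cons.
apply: integrable_realD => //; under eq_fun do rewrite exprMn mulrC.
by apply: integrable_realZ; exact: integrable_sqr_affine.
Qed.

Lemma J_dist2_le p : (forall s, s \in p -> 0 < d s.1.1.1) ->
  J[setT] (fun w => dist2 p (V w)) <= (size p)%:R.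
Proof.
have [sT _] := cellT.
elim: p => [|s p ih] dp.
  under eq_fun do rewrite /dist2 big_nil.
  by rewrite J_cst// mul0r.
under eq_fun do rewrite /dist2 big_cons.
have dp0 : 0 < d s.1.1.1 by apply: dp; rewrite mem_head.
have E w : (coord s.1.1.1 0 (V w) / d s.1.1.1) ^+ 2 =
    (d s.1.1.1 ^+ 2)^-1 * coord s.1.1.1 0 (V w) ^+ 2.
  by rewrite expr_div_n mulrC.
under eq_fun do rewrite E.
rewrite JD//; last 2 first.
- by apply: integrable_realZ; exact: integrable_sqr_affine.
- exact: integrable_dist2.
rewrite JZ//; last exact: integrable_sqr_affine.
rewrite /= -natr1 addrC; apply: lerD.
  by apply: ih => t tp; apply: dp; rewrite in_cons tp orbT.
rewrite mulrC ler_pdivrMr ?exprn_gt0// mul1r; exact: d_sqr.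
Qed.

Lemma continuous_dist2 p : continuous (dist2 p).
Proof.
move=> x; apply: (@continuous_big _ _ +%R) => [|s _]; first exact: add_continuous.
rewrite (_ : (fun z => _) =
  (fun u : R => (u / d s.1.1.1) ^+ 2) \o coord s.1.1.1 0)//.
move=> z; apply: continuous_comp; first exact: continuous_affine.
apply: (@continuous_comp _ _ _ (fun u : R => u / d s.1.1.1) (fun u : R => u ^+ 2)).
  exact: mulrr_continuous.
exact: exprn_continuous.
Qed.

Definition typical p : set 'rV[R]_n := [set z | dist2 p z < 2 * (size p)%:R].

Lemma sigma_compact_typical p : sigma_compact (typical p).
Proof. exact/sigma_compact_lt/continuous_dist2. Qed.

Lemma J_indic A B : sigma_compact A -> sigma_compact B -> B `<=` A ->
  J[A] (\1_(V @^-1` B)) = pr B.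
Proof.
move=> sA sB BA.
rewrite /Rintegral integral_indic; try exact: sigma_compact_measurable.
by rewrite /pr setIidl// => w; exact: BA.
Qed.

Lemma integrable_pr_indic B : sigma_compact B ->
  P.-integrable setT (EFin \o (\1_(V @^-1` B) : T -> R)).
Proof. by move=> sB; apply: integrable_indic; exact: sigma_compact_measurable. Qed.

Lemma pr_setT : pr setT = 1.
Proof. by rewrite /pr preimage_setT probability_setT. Qed.

(** Markov's inequality for [dist2 p], each summand of which has expectation at most 1. *)
Lemma pr_typical_ge p : (0 < size p)%N -> (forall s, s \in p -> 0 < d s.1.1.1) ->
  2^-1 <= pr (typical p).
Proof.
move=> p0 dp; have [sT _] := cellT.
have sB := sigma_compact_typical p.
have k0 : 0 < (size p)%:R :> R by rewrite ltr0n.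
have : J[setT] (fun w => 2 * (size p)%:R + - (2 * (size p)%:R) * \1_(V @^-1` typical p) w)
    <= J[setT] (fun w => dist2 p (V w)).
  apply: J_le => //.
  - apply: integrable_realD; first exact: integrable_cst.
    by apply: integrable_realZ; exact: integrable_pr_indic.
  - exact: integrable_dist2.
  - move=> w _; rewrite indicE; case: (boolP (_ \in _)) => [h|].
      by rewrite /= mulr1 subrr sumr_ge0// => s _; exact: sqr_ge0.
    rewrite notin_setE /= mulr0 addr0 /typical/= => /negP.
    by rewrite -leNgt.
rewrite JD//; last 2 first.
- exact: integrable_cst.
- by apply: integrable_realZ; exact: integrable_pr_indic.
rewrite J_cst// JZ//; last exact: integrable_pr_indic.
rewrite J_indic// pr_setT => h.
have := le_trans h (J_dist2_le dp); nra.
Qed.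

Lemma pr_conv_typical_ge A p : cell A -> (0 < size p)%N ->
  (forall s, s \in p -> 0 < d s.1.1.1) ->
  pr (descend A p) `^ l / 2 <= pr (set_conv l (descend A p) (typical p)).
Proof.
move=> cA p0 dp; have [sL _] := cell_descend p cA.
have := @log_concave_sigma_compact _ _ l _ sL (sigma_compact_typical p).
rewrite l0 l1 => /(_ isT); apply: le_trans.
rewrite ler_wpM2l ?powR_ge0//.
have h := pr_typical_ge p0 dp.
apply: (@le_trans _ _ (2^-1 `^ (1 - l))).
  rewrite -[leLHS]powRr1 ?invr_ge0//; apply: ger_powR.
    by rewrite invr_gt0 ltr0n invf_le1// ler1n.
  by rewrite gerBl ltW.
by apply: ge0_ler_powR; rewrite ?nnegrE ?pr_ge0 ?subr_ge0 ?invr_ge0// ltW.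
Qed.

(** The pointwise inequality for the weights is integrated against the law of [X]. On [E p] the
    weight is at least [expR (- (2 * k / K ^ 2))], and by log-concavity [E p] has mass at least
    [expR (- (l * V0)) / 2] when the leaf has mass at least [expR (- V0)]. The sets [E p] may
    overlap. *)
Lemma bad_mass_le A k (BB : seq (seq node)) V0 : cell A -> (0 < k)%N ->
  (forall p, p \in BB -> size p = k /\ (forall s, s \in p -> 0 < d s.1.1.1)) ->
  (forall x, \sum_(p <- BB) pr (descend A p) * weight p x <=
    (1 - delta / 2) ^+ k * pr A) ->
  \sum_(p <- BB | expR (- V0) <= pr (descend A p)) pr (descend A p) <=
    2 * expR (2 * k%:R / K ^+ 2 + l * V0) * (1 - delta / 2) ^+ k * pr A.
Proof.
move=> cA k0 hBB hw; have [sT _] := cellT.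
pose E p := set_conv l (descend A p) (typical p).
have sE p : sigma_compact (E p).
  apply: sigma_compact_set_conv; last exact: sigma_compact_typical.
  by have [] := cell_descend p cA.
pose e := expR (- (2 * k%:R / K ^+ 2)).
pose c p := if expR (- V0) <= pr (descend A p) then pr (descend A p) * e else 0.
have c0 p : 0 <= c p.
  by rewrite /c; case: ifP => _//; rewrite mulr_ge0 ?pr_ge0 ?expR_ge0.
have iS (s : seq (seq node)) : P.-integrable setT
    (EFin \o (fun w => \sum_(p <- s) c p * \1_(V @^-1` E p) w)).
  elim: s => [|p s ih].
    by under eq_fun do rewrite big_nil; exact: integrable_cst.
  under eq_fun do rewrite big_cons.
  apply: integrable_realD => //.
  by apply: integrable_realZ; exact: integrable_pr_indic.
have JS (s : seq (seq node)) :
    J[setT] (fun w => \sum_(p <- s) c p * \1_(V @^-1` E p) w) =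
    \sum_(p <- s) c p * pr (E p).
  elim: s => [|p s ih].
    by under eq_fun do rewrite big_nil; rewrite big_nil J_cst// mul0r.
  under eq_fun do rewrite big_cons.
  rewrite JD//; last by apply: integrable_realZ; exact: integrable_pr_indic.
  rewrite JZ//; last exact: integrable_pr_indic.
  by rewrite J_indic// big_cons ih.
have : \sum_(p <- BB) c p * pr (E p) <= (1 - delta / 2) ^+ k * pr A.
  rewrite -JS.
  apply: (@le_trans _ _ (J[setT] (fun=> (1 - delta / 2) ^+ k * pr A))); last first.
    by rewrite J_cst// pr_setT mulr1.
  apply: J_le => //; first exact: integrable_cst.
  move=> w _; apply: le_trans (hw (V w)).
  rewrite !big_seq; apply: ler_sum => p pB.
  have [pk dp] := hBB p pB.
  rewrite /c; case: ifP => _; last by rewrite mul0r mulr_ge0 ?pr_ge0 ?weight_ge0.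
  rewrite -mulrA ler_wpM2l ?pr_ge0// indicE.
  have [|_] := boolP (_ \in _); last by rewrite mulr0 weight_ge0.
  move=> /set_mem [y Ly [z zt <-]]; rewrite /= mulr1.
  apply: le_trans (weight_conv_ge z dp Ly).
  rewrite /e ler_expR lerN2 ler_pM2r ?invr_gt0 ?exprn_gt0//.
  by apply/ltW; move: zt; rewrite /typical /= pk.
move=> h.
have h2 : \sum_(p <- BB | expR (- V0) <= pr (descend A p))
    (e * expR (- (l * V0)) / 2) * pr (descend A p) <= (1 - delta / 2) ^+ k * pr A.
  apply: le_trans h; rewrite big_mkcond !big_seq; apply: ler_sum => p pB.
  have [pk dp] := hBB p pB.
  rewrite /c; case: ifP => [big|_]; last by rewrite mul0r.
  rewrite -[leLHS]mulrC -[leRHS]mulrA ler_wpM2l ?pr_ge0// -mulrA.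
  rewrite ler_wpM2l ?expR_ge0//.
  apply: le_trans (pr_conv_typical_ge cA _ dp); last by rewrite pk.
  rewrite ler_pM2r//.
  have -> : expR (- (l * V0)) = expR (- V0) `^ l.
    by rewrite /powR gt_eqF ?expR_gt0// expRK mulrN.
  by apply: ge0_ler_powR; rewrite ?nnegrE ?expR_ge0 ?pr_ge0// ltW.
move: h2; rewrite -mulr_sumr mulrC.
have -> : e * expR (- (l * V0)) / 2 = (2 * expR (2 * k%:R / K ^+ 2 + l * V0))^-1.
  by rewrite invfM -expRN opprD expRD -/e; ring.
rewrite ler_pdivrMr; last by rewrite mulr_gt0// expR_gt0.
by move=> /le_trans; apply; rewrite mulrC mulrA.
Qed.

End Tree.

(** [dlt] is the fraction of mass supplied by [pr_gt_mean]. [Kst] and [lam] are such that in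
    [bad_mass_le] the losses [2 * k / K ^ 2] and [l * V0] stay below the gain [k * dlt / 2], and
    [gap] is the least value allowed by [2 * K <= l * G]. *)
Definition dlt : R := locked (32 * C_sqr)^-1.
Definition Kst : R := locked (16 / dlt).
Definition lam : R := locked (dlt / 24).
Definition gap : R := locked (2 * Kst / lam).

Lemma dlt_bounds : 0 < dlt <= 1.
Proof.
have := C_sqr_ge1; rewrite /dlt -lock; move: C_sqr => C C1.
rewrite invr_gt0 invf_le1; last by lra.
by apply/andP; split; lra.
Qed.

Lemma Kst_gt0 : 0 < Kst.
Proof.
have := dlt_bounds; rewrite /Kst -lock; move: dlt => e /andP[e0 _].
by rewrite divr_gt0.
Qed.

Lemma lam_bounds : 0 < lam < 1.
Proof.
have := dlt_bounds; rewrite /lam -lock; move: dlt => e /andP[? ?].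
by apply/andP; split; lra.
Qed.

Lemma gap_gt0 : 0 < gap.
Proof.
have := Kst_gt0; have /andP[] := lam_bounds; rewrite /gap -lock.
by move: lam Kst => l k l0 _ k0; rewrite divr_gt0// mulr_gt0.
Qed.

Lemma gap_lam : 2 * Kst <= lam * gap.
Proof.
have /andP[] := lam_bounds; rewrite /gap -lock.
by move: lam Kst => l k l0 _; rewrite [leRHS]mulrC divfK// gt_eqF.
Qed.

(** * Leaves without spread coordinates *)

Section GoodCells.
Context (d : 'I_n -> R).
Context (d_sqr : forall i, J[setT] (fun w => coord i 0 (V w) ^+ 2) <= d i ^+ 2).

(** About [4 / dlt * (U + H)] cuts are made, and [W = U + 3 * k]. There are at most [3 ^ k] leaves,
    so those of mass below [expR (- W)] have total mass at most [(3 * expR (- 3)) ^ k * pr A], hence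
    at most [expR (- H) * pr A]. The other leaves of depth [k] are handled by [bad_mass_le]; they
    account for the remaining [2 * expR (- H) * pr A]. *)
Lemma good_cells A (U H : R) : cell A -> pr A = expR (- U) -> 0 <= U -> 0 <= H ->
  exists (GG RR : seq (seq node)) (W : R),
  [/\ forall p, p \in GG -> ~ spread d gap dlt (descend A p) /\
        expR (- W) <= pr (descend A p),
      forall f, P.-integrable setT (EFin \o f) ->
        J[A] f = \sum_(p <- GG) J[descend A p] f + \sum_(p <- RR) J[descend A p] f,
      \sum_(p <- RR) pr (descend A p) <= 3 * expR (- H) * pr A,
      0 <= W &
      W <= U + 3 * (4 / dlt * (U + H) + 1)].
Proof.
move=> cA prA U0 H0; have [sA _] := cA.
have /andP[dl0 dl1] := dlt_bounds; have /andP[lm0 lm1] := lam_bounds.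
set q := 4 / dlt * (U + H).
have q0 : 0 <= q by rewrite mulr_ge0 ?divr_ge0 ?addr_ge0// ltW.
pose k := (Num.truncn q).+1.
have qk : q < k%:R by rewrite truncnS_gt.
have kq : k%:R <= q + 1 by rewrite -natr1 lerD2r truncn_le.
have [GG [BB [hG hB hJ hs hw]]] := tree_decomposition d gap_lam lm0 dlt_bounds
  (ltW gap_gt0) k cA.
pose W := U + 3 * k%:R.
pose big p := expR (- W) <= pr (descend A p).
exists [seq p <- GG | big p], ([seq p <- GG | ~~ big p] ++ BB), W; split.
- by move=> p; rewrite mem_filter => /andP[? /hG].
- move=> f fi; rewrite (hJ f fi) big_cat !big_filter /=.
  by rewrite (bigID big) /= addrA.
- have small_le (s : seq (seq node)) :
      \sum_(p <- s | ~~ big p) pr (descend A p) <= (size s)%:R * expR (- W).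
    elim: s => [|p s ih]; first by rewrite big_nil mul0r.
    rewrite big_cons /= -natr1 mulrDl mul1r.
    case: ifPn => [|_]; last by have := expR_ge0 (- W); lra.
    rewrite /big -ltNge => /ltW; lra.
  have bad : \sum_(p <- BB | big p) pr (descend A p) <= 2 * expR (- H) * pr A.
    have := bad_mass_le lm0 (ltW Kst_gt0) lm1 Kst_gt0 d_sqr W cA (ltn0Sn _) hB hw.
    move=> /le_trans; apply; rewrite ler_wpM2r ?pr_ge0// -mulrA ler_pM2l//.
    have rho : (1 - dlt / 2) ^+ k <= expR (- (k%:R * dlt / 2)).
      have -> : - (k%:R * dlt / 2) = k%:R * - (dlt / 2) by ring.
      rewrite expRM_natl; apply: lerXn2r; rewrite ?nnegrE ?expR_ge0//; first lra.
      exact: expR_ge1Dx.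
    apply: le_trans (ler_wpM2l (expR_ge0 _) rho) _.
    rewrite -expRD ler_expR.
    have kd : 4 * (U + H) <= k%:R * dlt.
      by rewrite -ler_pdivrMr// mulrAC ltW.
    have kd2 : k%:R * dlt * dlt <= k%:R * dlt by rewrite ler_piMr// mulr_ge0// ltW.
    have Ud : U * dlt <= U by rewrite ler_piMr.
    have -> : 2 * k%:R / Kst ^+ 2 = k%:R * dlt * dlt / 128.
      rewrite /Kst -lock; move: dlt dl0 => e e0; field.
      by rewrite gt_eqF.
    have -> : lam * W = (U * dlt + 3 * (k%:R * dlt)) / 24.
      by rewrite /lam -lock /W; field.
    lra.
  rewrite big_cat big_filter /= [X in _ + X](bigID big) /=.
  have h1 := small_le GG; have h2 := small_le BB.
  have h3 : ((size GG)%:R + (size BB)%:R) * expR (- W) <= expR (- H) * pr A.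
    have h31 : (3 : R) ^+ k * expR (- (3 * k%:R)) <= expR (- H).
      apply: (@le_trans _ _ (expR (- k%:R))).
        have -> : - (3 * k%:R) = k%:R * - 3 :> R by ring.
        have -> : - k%:R = k%:R * - 1 :> R by ring.
        rewrite !expRM_natl -exprMn; apply: lerXn2r.
        - by rewrite nnegrE mulr_ge0// expR_ge0.
        - by rewrite nnegrE expR_ge0.
        have -> : expR (- 3) = expR (- 1) * expR (- 2) :> R by rewrite -expRD; congr expR; lra.
        rewrite mulrCA ler_piMr ?expR_ge0// expRN ler_pdivrMr ?expR_gt0// mul1r.
        by apply: le_trans (expR_ge1Dx _); lra.
      rewrite ler_expR lerN2; apply: le_trans (ltW qk).
      have : 1 <= 4 / dlt by rewrite ler_pdivlMr//; lra.
      rewrite /q; nra.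
    rewrite prA /W opprD expRD mulrCA [leRHS]mulrC ler_wpM2l ?expR_ge0//.
    apply: le_trans h31; rewrite ler_wpM2r ?expR_ge0//.
    by rewrite -natrD -natrX ler_nat.
  lra.
- by rewrite addr_ge0// mulr_ge0.
- by rewrite /W; lra.
Qed.

Lemma coord_shift i (c c' : R) (x : 'rV[R]_n) : coord i c x = coord i c' x + (c' - c).
Proof. by rewrite !coordE; ring. Qed.

Lemma J_coord A i (c : R) : sigma_compact A ->
  J[A] (fun w => coord i c (V w)) = J[A] (fun w => coord i 0 (V w)) - c * pr A.
Proof.
move=> sA; rewrite -mulNr -J_cst// -JD//; last 2 first.
- exact: integrable_affine.
- exact: integrable_cst.
by congr Rintegral; apply/funext => w; rewrite (coord_shift i c 0) sub0r.
Qed.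

Lemma pr_dlt_le A v m (s : R) : cell A -> 0 < s ->
  J[A] (fun w => affine v m (V w)) = 0 ->
  J[A] (fun w => `|affine v m (V w)|) = s * pr A ->
  dlt * pr A <= pr (A `&` [set x | s / 8 < affine v m x]).
Proof.
move=> cA s0 h0 h1; have := pr_gt_mean cA s0 h0 h1.
have := C_sqr_gt0; rewrite /dlt -lock; move: C_sqr => C C0.
by rewrite ler_pdivrMl// mulr_gt0.
Qed.

(** If the mean deviation [s] exceeded [4 * gap * d i], then [pr_gt_mean], applied to the centred
    coordinate and to its negative, would give two slabs beyond [m - s / 8] and [m + s / 8], each of
    relative mass [dlt] and more than [gap * d i] apart. *)
Lemma nonspread_deviation_le A i : cell A -> 0 < pr A -> 0 < d i ->
  ~ spread d gap dlt A ->
  J[A] (fun w => `|coord i (J[A] (fun w => coord i 0 (V w)) / pr A) (V w)|) <=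
    4 * gap * d i * pr A.
Proof.
move=> cA A0 di nA; have [sA _] := cA.
set m := _ / pr A.
have mean0 : J[A] (fun w => coord i m (V w)) = 0.
  by rewrite J_coord// /m divfK ?gt_eqF// subrr.
set S := J[A] _; rewrite leNgt; apply/negP => hS.
have g0 := gap_gt0.
pose s := S / pr A.
have SE : S = s * pr A by rewrite /s divfK// gt_eqF.
have hs : 4 * gap * d i < s by rewrite /s ltr_pdivlMr.
have s0 : 0 < s by apply: lt_trans hs; rewrite !mulr_gt0.
apply: nA; exists i, (m - s / 8), (m + s / 8); split => //.
- lra.
- have E w : affine (- delta_mx 0 i) (- m) w = - coord i m w.
    rewrite /coord /affine; under eq_bigr do rewrite mxE mulNr.
    by rewrite sumrN opprB addrC opprK.
  have h1 : J[A] (fun w => affine (- delta_mx 0 i) (- m) (V w)) = 0.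
    under eq_fun do rewrite E -mulN1r.
    by rewrite JZ//; [rewrite mean0 mulr0|exact: integrable_affine].
  have h2 : J[A] (fun w => `|affine (- delta_mx 0 i) (- m) (V w)|) = s * pr A.
    by under eq_fun do rewrite E normrN.
  have := pr_dlt_le cA s0 h1 h2; congr (_ <= pr (_ `&` _)).
  by apply/seteqP; split => x /=; rewrite E !coordE; lra.
- have := pr_dlt_le cA s0 mean0 SE; congr (_ <= pr (_ `&` _)).
  by apply/seteqP; split => x /=; rewrite -/(coord i m x) !coordE; lra.
Qed.

(** * The key estimate *)

Definition moment_bound (p s : R) (v : 'rV[R]_n) : Prop :=
  J[setT] (fun w => `|affine v 0 (V w)| `^ p) <= s `^ p.

(** Markov's inequality for the [p]-th power at the level [expR 1 * s] gives a tail of mass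
    [expR (- p)], as Borell's lemma requires. *)
Lemma exp_moment_bound (p s : R) v : 1 <= p -> 0 < s -> moment_bound p s v ->
  (\int[P]_w (expR (p * `|affine v 0 (V w)| / (8 * (expR 1 * s))))%:E <=
    (9 * expR p)%:E)%E.
Proof.
move=> p1 s0 hv; have [sT _] := cellT.
have p0 : 0 < p by lra.
have a0 : 0 < expR 1 * s by rewrite mulr_gt0// expR_gt0.
have tl : pr (tail setT v 0 (expR 1 * s)) <= expR (- p) * pr setT.
  rewrite pr_setT mulr1.
  set B := tail _ _ _ _; have sB : sigma_compact B by exact: sigma_compact_tail.
  have : J[setT] (fun w => (expR 1 * s) `^ p * \1_(V @^-1` B) w) <= s `^ p.
    apply: le_trans hv; apply: J_le => //.
    - by apply: integrable_realZ; exact: integrable_pr_indic.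
    - exact: integrable_powR_affine.
    - move=> w _; rewrite indicE; have [|_] := boolP (_ \in _); last first.
        by rewrite mulr0 powR_ge0.
      move=> /set_mem [_ /= wB]; rewrite mulr1.
      by apply: ge0_ler_powR => //; rewrite ?nnegrE ltW.
  rewrite JZ//; last exact: integrable_pr_indic.
  rewrite J_indic// powRM ?expR_ge0//; last exact: ltW.
  have -> : expR 1 `^ p = expR p by rewrite /powR gt_eqF ?expR_gt0// expRK mulr1.
  rewrite mulrAC -[leRHS]mul1r ler_pM2r ?powR_gt0//.
  by rewrite expRN -ler_pdivlMl ?expR_gt0// mulr1.
have := integral_expR_affine_le cellT a0 p1 tl.
by rewrite preimage_setT pr_setT mulr1.
Qed.

(** Integrate [x <= S - 1 + expR (x - S)] over [A], for [x] a multiple of the functional and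
    [S = ln 9 + p + W]. The exponential term contributes at most [expR (- W)], which is at most
    [pr A]: a small mass costs only its logarithm. *)
Lemma mean_bound A (p s W : R) v : cell A -> 1 <= p -> 0 < s ->
  moment_bound p s v -> expR (- W) <= pr A ->
  J[A] (fun w => `|affine v 0 (V w)|) <=
    8 * expR 1 * s / p * (ln 9 + p + W) * pr A.
Proof.
move=> cA p1 s0 hv hW; have [sA _] := cA.
have p0 : 0 < p by lra.
pose th := p / (8 * (expR 1 * s)).
have th0 : 0 < th by rewrite divr_gt0// !mulr_gt0// expR_gt0.
have hE := exp_moment_bound p1 s0 hv.
have E w : p * `|affine v 0 (V w)| / (8 * (expR 1 * s)) = th * `|affine v 0 (V w)|.
  by rewrite /th mulrAC.
move: hE; under eq_integral do rewrite E.
move=> {E} hE.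
pose S := ln 9 + p + W.
have iE : P.-integrable setT
    (EFin \o (fun w => expR (th * `|affine v 0 (V w)|))).
  apply: (@integrable_le_expR v 0 _ 1 th) => //.
  - apply: measurableT_comp => //; apply: measurable_funM => //.
    by apply: measurableT_comp => //; exact: measurable_affine.
  - exact: le_lt_trans hE (ltry _).
  - by move=> w; rewrite mul1r ger0_norm ?expR_ge0.
have h1 : J[A] (fun w => th * `|affine v 0 (V w)|) <=
    J[A] (fun w => (S - 1) + expR (- S) * expR (th * `|affine v 0 (V w)|)).
  apply: J_le => //.
  - by apply: integrable_realZ; exact: integrable_norm_affine.
  - by apply: integrable_realD; [exact: integrable_cst|exact: integrable_realZ].
  - move=> w _; rewrite -expRD.
    by have := expR_ge1Dx (- S + th * `|affine v 0 (V w)|); lra.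
have h2 : J[A] (fun w => expR (th * `|affine v 0 (V w)|)) <= 9 * expR p.
  rewrite -lee_fin JE//; apply: le_trans hE.
  apply: ge0_subset_integral => //.
  - exact: sigma_compact_measurable.
  - by have /integrableP[] := iE.
rewrite JZ// in h1; last exact: integrable_norm_affine.
rewrite JD// in h1; last 2 first.
- exact: integrable_cst.
- exact: integrable_realZ.
rewrite J_cst// JZ// in h1.
have h3 : expR (- S) * (9 * expR p) = expR (- W).
  rewrite -[9 in LHS]lnK ?posrE// -!expRD; congr expR; rewrite /S; lra.
have h4 : th * J[A] (fun w => `|affine v 0 (V w)|) <= S * pr A.
  have : expR (- S) * J[A] (fun w => expR (th * `|affine v 0 (V w)|)) <= expR (- W).
    by rewrite -h3 ler_wpM2l ?expR_ge0.
  by move: h1 hW; lra.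
rewrite -(ler_pM2l th0); apply: le_trans h4 _.
rewrite le_eqVlt; apply/orP; left; apply/eqP; rewrite /th -/S; field.
by rewrite !gt_eqF ?expR_gt0.
Qed.

Lemma J_ge0 A (f : T -> R) : (forall w, 0 <= f w) -> 0 <= J[A] f.
Proof. by move=> f0; apply: Rintegral_ge0. Qed.

(** Use [x <= Th + x ^ 2 / Th] with [Th = 8 * C_sqr * M]: the constant is controlled by the small
    total mass, the square by the second moment on all of [A], and each part gives an eighth. *)
Lemma rest_le A v c (M : R) (GG RR : seq (seq node)) : cell A -> 0 < M ->
  J[A] (fun w => `|affine v c (V w)|) = M * pr A ->
  (forall f, P.-integrable setT (EFin \o f) ->
    J[A] f = \sum_(p <- GG) J[descend A p] f + \sum_(p <- RR) J[descend A p] f) ->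
  \sum_(p <- RR) pr (descend A p) <= pr A / (64 * C_sqr) ->
  \sum_(p <- RR) J[descend A p] (fun w => `|affine v c (V w)|) <= M * pr A / 4.
Proof.
move=> cA M0 hM hJ hR.
have sD p : sigma_compact (descend A p) by have [] := cell_descend p cA.
have i3 := integrable_sqr_affine v c.
have h2 : \sum_(p <- RR) J[descend A p] (fun w => affine v c (V w) ^+ 2) <=
    C_sqr * M ^+ 2 * pr A.
  have := sqr_moment_le cA M0; rewrite -hM => /(_ _ _ (lexx _)); apply: le_trans.
  rewrite (hJ _ i3) lerDr sumr_ge0// => p _; apply: J_ge0 => w; exact: sqr_ge0.
have := C_sqr_gt0; move: C_sqr hR h2 => C hR h2 C0.
have [Th Th0 ThE] : exists2 Th : R, 0 < Th & Th = 8 * C * M.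
  by exists (8 * C * M) => //; rewrite !mulr_gt0.
have h1 p : J[descend A p] (fun w => `|affine v c (V w)|) <=
    Th * pr (descend A p) + Th^-1 * J[descend A p] (fun w => affine v c (V w) ^+ 2).
  rewrite -J_cst// -JZ// -JD//; last 2 first.
  - exact: integrable_cst.
  - exact: integrable_realZ.
  apply: J_le => //.
  - exact: integrable_norm_affine.
  - by apply: integrable_realD; [exact: integrable_cst|exact: integrable_realZ].
  - move=> w _; rewrite -[_ ^+ 2]real_normK ?num_real//; move: `|_| => z.
    rewrite -(ler_pM2l Th0) mulrDr mulVKf ?gt_eqF//; nra.
apply: (@le_trans _ _ (Th * \sum_(p <- RR) pr (descend A p) +
    Th^-1 * \sum_(p <- RR) J[descend A p] (fun w => affine v c (V w) ^+ 2))).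
  by rewrite !mulr_sumr -big_split /=; apply: ler_sum => p _; exact: h1.
have h3 : Th * \sum_(p <- RR) pr (descend A p) <= M * pr A / 8.
  apply: le_trans (ler_wpM2l (ltW Th0) hR) _; rewrite ThE.
  by rewrite le_eqVlt; apply/orP; left; apply/eqP; field; rewrite gt_eqF.
have h4 : Th^-1 * \sum_(p <- RR) J[descend A p] (fun w => affine v c (V w) ^+ 2)
    <= M * pr A / 8.
  rewrite ler_pdivrMl//; apply: (le_trans h2); rewrite ThE.
  by rewrite le_eqVlt; apply/orP; left; apply/eqP; field.
lra.
Qed.

(** The value of [H] for which the mass discarded by [good_cells] meets the hypothesis of
    [rest_le]. *)
Definition log_mass : R := locked (ln (192 * C_sqr)).

Lemma log_mass_ge0 : 0 <= log_mass.
Proof.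
have := C_sqr_ge1; rewrite /log_mass -lock; move: C_sqr => C C1.
by apply: ln_ge0; lra.
Qed.

Lemma expR_log_mass : 3 * expR (- log_mass) = (64 * C_sqr)^-1.
Proof.
have := C_sqr_ge1; rewrite /log_mass -lock; move: C_sqr => C C1.
rewrite expRN lnK ?posrE; last by lra.
by field; rewrite gt_eqF//; lra.
Qed.

Definition C_key : R := locked
  (16 * expR 1 * (ln 9 + 5 + 12 * log_mass / dlt + 12 / dlt)).

Lemma C_key_gt0 : 0 < C_key.
Proof.
have := log_mass_ge0; have /andP[] := dlt_bounds; rewrite /C_key -lock.
move: log_mass dlt => H e e0 _ H0; rewrite mulr_gt0// ?mulr_gt0 ?expR_gt0//.
have : 0 <= ln 9 :> R by apply: ln_ge0; rewrite ler1n.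
have : 0 <= 12 * H / e by rewrite divr_ge0 ?mulr_ge0// ltW.
have : 0 < 12 / e by rewrite divr_gt0.
lra.
Qed.

Lemma spread_sum_le A (p s U : R) (v : 'rV[R]_n) :
  cell A -> pr A = expR (- U) -> 0 <= U -> 1 <= p -> 0 < s ->
  (forall i, 0 <= v 0 i) ->
  (forall u : 'rV[R]_n, (forall i, `|u 0 i| <= v 0 i) -> moment_bound p s u) ->
  \sum_(i < n | (0 < d i) &&
       (16 * gap * d i * pr A < J[A] (fun w => `|coord i 0 (V w)|)))
    v 0 i * J[A] (fun w => `|coord i 0 (V w)|) <=
  C_key * s * (1 + U / p) * pr A.
Proof.
move=> cA prA U0 p1 s0 v0 hv; have [sA _] := cA.
have A0 : 0 < pr A by rewrite prA expR_gt0.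
have [GG [RR [W [hG hJ hR W0 W1]]]] := good_cells cA prA U0 log_mass_ge0.
pose I (i : 'I_n) := (0 < d i) &&
  (16 * gap * d i * pr A < J[A] (fun w => `|coord i 0 (V w)|)).
rewrite (eq_bigl I)//.
have sD q : sigma_compact (descend A q) by have [] := cell_descend q cA.
have hR' : \sum_(q <- RR) pr (descend A q) <= pr A / (64 * C_sqr).
  by rewrite -expR_log_mass [leRHS]mulrC.
pose m i q := J[descend A q] (fun w => coord i 0 (V w)).
have sumG : \sum_(q <- GG) pr (descend A q) <= pr A.
  rewrite (pr_J sA) hJ; last exact: integrable_cst.
  under eq_bigr do rewrite pr_J//.
  by rewrite lerDl sumr_ge0// => q _; exact: J_ge0.
(* The discarded cells carry at most a quarter of the integral. The deviations within the good
   leaves sum to at most [4 * gap * d i * pr A], again at most a quarter by the definition of [I].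
   Half is left for the means over the leaves. *)
have coordwise i : I i -> J[A] (fun w => `|coord i 0 (V w)|) / 2 <=
    \sum_(q <- GG) `|m i q|.
  move=> /andP[di hi].
  pose M := J[A] (fun w => `|coord i 0 (V w)|) / pr A.
  have ME : J[A] (fun w => `|coord i 0 (V w)|) = M * pr A by rewrite /M divfK// gt_eqF.
  have g0 := gap_gt0.
  have M0 : 0 < M.
    rewrite /M divr_gt0//; apply: lt_trans hi; by rewrite !mulr_gt0.
  have hrest := rest_le cA M0 ME hJ hR'.
  have hleaf q : q \in GG -> J[descend A q] (fun w => `|coord i 0 (V w)|) <=
      `|m i q| + 4 * gap * d i * pr (descend A q).
    move=> qG; have [nsq Wq] := hG q qG.
    have q0 : 0 < pr (descend A q) by apply: lt_le_trans Wq; rewrite expR_gt0.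
    have := nonspread_deviation_le (cell_descend q cA) q0 di nsq.
    rewrite -/(m i q) => hdev.
    apply: (@le_trans _ _ (J[descend A q] (fun w => `|m i q / pr (descend A q)| +
        `|coord i (m i q / pr (descend A q)) (V w)|))).
      apply: J_le => //.
      - exact: integrable_norm_affine.
      - by apply: integrable_realD; [exact: integrable_cst|exact: integrable_norm_affine].
      - move=> w _; rewrite (coord_shift i 0 (m i q / pr (descend A q))) subr0.
        by rewrite addrC; apply: le_trans (ler_normD _ _) _; rewrite addrC.
    rewrite JD//; last 2 first.
    - exact: integrable_cst.
    - exact: integrable_norm_affine.
    by rewrite J_cst// normrM normfV (gtr0_norm q0) divfK ?gt_eqF// lerD2l.
  have : J[A] (fun w => `|coord i 0 (V w)|) <=
     \sum_(q <- GG) (`|m i q| + 4 * gap * d i * pr (descend A q)) + M * pr A / 4.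
    rewrite (hJ _ (integrable_norm_affine _ _)); apply: lerD => //.
    by rewrite !big_seq; apply: ler_sum => q; exact: hleaf.
  rewrite big_split /= -mulr_sumr.
  have : 4 * gap * d i * \sum_(q <- GG) pr (descend A q) <= 4 * gap * d i * pr A.
    by rewrite ler_wpM2l// !mulr_ge0// ltW.
  move: hi; rewrite ME; lra.
have hleaf q : q \in GG -> \sum_(i < n | I i) v 0 i * `|m i q| <=
    8 * expR 1 * s / p * (ln 9 + p + W) * pr (descend A q).
  move=> qG; have [_ Wq] := hG q qG.
  (* The signs depend on the leaf [q]; [u] is still dominated by [v], so the moment bound applies to
     it. *)
  pose u : 'rV[R]_n := \row_i (if I i then Num.sg (m i q) * v 0 i else 0).
  have hu : moment_bound p s u.
    apply: hv => i; rewrite mxE; case: ifP => _; last by rewrite normr0.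
    rewrite normrM (ger0_norm (v0 i)) ler_piMl//.
    by rewrite normr_sg lern1 leq_b1.
  apply: le_trans (mean_bound (cell_descend q cA) p1 s0 hu Wq).
  apply: (@le_trans _ _ (J[descend A q] (fun w => affine u 0 (V w)))); last first.
    apply: J_le => //; first exact: integrable_affine.
      exact: integrable_norm_affine.
    by move=> w _; exact: ler_norm.
  have -> : J[descend A q] (fun w => affine u 0 (V w)) =
      \sum_(i < n) u 0 i * m i q.
    have JS (r : seq 'I_n) : P.-integrable setT (EFin \o
        (fun w => \sum_(i <- r) u 0 i * coord i 0 (V w))) /\
        J[descend A q] (fun w => \sum_(i <- r) u 0 i * coord i 0 (V w)) =
        \sum_(i <- r) u 0 i * m i q.
      elim: r => [|i r [ih1 ih2]].
        under eq_fun do rewrite big_nil.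
        by split; [exact: integrable_cst|rewrite J_cst// mul0r big_nil].
      have ii : P.-integrable setT (EFin \o (fun w => u 0 i * coord i 0 (V w))).
        by apply: integrable_realZ; exact: integrable_affine.
      under eq_fun do rewrite big_cons; split; first exact: integrable_realD.
      rewrite JD// ih2 JZ//; last exact: integrable_affine.
      by rewrite big_cons.
    have [_ <-] := JS (index_enum 'I_n).
    congr Rintegral; apply/funext => w; rewrite /affine subr0.
    by apply: eq_bigr => i _; rewrite coordE subr0.
  rewrite big_mkcond; apply: ler_sum => i _; rewrite mxE.
  by case: ifP => _; rewrite ?mul0r// normrEsg mulrCA mulrA.
have total : \sum_(i < n | I i) v 0 i * J[A] (fun w => `|coord i 0 (V w)|) <=
    2 * (8 * expR 1 * s / p * (ln 9 + p + W)) * pr A.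
  apply: (@le_trans _ _ (\sum_(i < n | I i) v 0 i * (2 * \sum_(q <- GG) `|m i q|))).
    apply: ler_sum => i Ii; rewrite ler_wpM2l//.
    by have := coordwise i Ii; lra.
  under eq_bigr do rewrite mulrCA mulr_sumr.
  rewrite -mulr_sumr exchange_big /= -mulrA ler_pM2l//.
  apply: (@le_trans _ _ (\sum_(q <- GG)
      8 * expR 1 * s / p * (ln 9 + p + W) * pr (descend A q))).
    by rewrite !big_seq; apply: ler_sum => q; exact: hleaf.
  rewrite -mulr_sumr ler_wpM2l//.
  have l9 : 0 <= ln 9 :> R by apply: ln_ge0; rewrite ler1n.
  apply: mulr_ge0; last by lra.
  by rewrite divr_ge0 ?mulr_ge0 ?expR_ge0//; lra.
apply: (le_trans total); rewrite ler_wpM2r ?pr_ge0//.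
have l9 : 0 <= ln 9 :> R by apply: ln_ge0; rewrite ler1n.
have H0 := log_mass_ge0; have /andP[e0 _] := dlt_bounds.
have p0 : 0 < p by lra.
have {total coordwise hleaf} -> :
    2 * (8 * expR 1 * s / p * (ln 9 + p + W)) =
    16 * expR 1 * s * (ln 9 * p^-1 + 1 + W * p^-1).
  by field; rewrite gt_eqF.
rewrite /C_key -lock -[leRHS]mulrA [leRHS]mulrAC -[leRHS]mulrA mulrC.
rewrite [leRHS](_ : _ = (16 * expR 1 * s) * ((ln 9 + 5 + 12 * log_mass / dlt + 12 / dlt)
  * (1 + U / p))); last by ring.
rewrite mulrC ler_wpM2l//; first by rewrite !mulr_ge0 ?expR_ge0// ltW.
move: W1 {hR hG hJ}; rewrite (_ : 4 / dlt * (U + log_mass) = 4 * dlt^-1 * U + 4 * (dlt^-1 * log_mass)); last by ring.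
rewrite (_ : 12 * log_mass / dlt = 12 * (dlt^-1 * log_mass)); last by ring.
have : 0 < dlt^-1 by rewrite invr_gt0.
have : 0 <= dlt^-1 * log_mass by rewrite mulr_ge0// invr_ge0 ltW.
have x0 : 0 < p^-1 by rewrite invr_gt0.
have x1 : p^-1 <= 1 by rewrite invf_le1.
have y0 : 0 <= U * p^-1 by rewrite mulr_ge0// ltW.
move: (dlt^-1 * log_mass) => E; move: (dlt^-1) => D E0 D0 W1.
have W2 : W * p^-1 <= U * p^-1 + 12 * D * (U * p^-1) + 12 * E * p^-1 + 3 * p^-1.
  have := ler_wpM2r (ltW x0) W1; lra.
have l9x : ln 9 * p^-1 <= ln 9 by rewrite ler_piMr.
have Ex : E * p^-1 <= E by rewrite ler_piMr.
have Ey : 0 <= E * (U * p^-1) by rewrite mulr_ge0.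
have Dy : 0 <= D * (U * p^-1) by rewrite mulr_ge0// ltW.
have ly : 0 <= ln 9 * (U * p^-1) by rewrite mulr_ge0.
lra.
Qed.

(** * Moments of the cut-off sum *)

Section Step.
Context (r p s t : R) (r1 : 1 <= r) (rp : r <= p) (s0 : 0 < s).
Context (weak_bound : forall u : 'rV[R]_n,
  lq_norm (hoelder_conjugate r%:E) u <= 1 -> moment_bound p s u).

Let r0 : 0 < r. Proof. exact: lt_le_trans r1. Qed.
Let p1 : 1 <= p. Proof. exact: le_trans rp. Qed.
Let p0 : 0 < p. Proof. exact: lt_le_trans p1. Qed.

Definition wide B (i : 'I_n) : bool :=
  (0 < d i) && (16 * gap * d i * pr B < J[B] (fun w => `|coord i 0 (V w)|)).

Lemma wide_powR_sum_le B (U : R) : cell B -> pr B = expR (- U) -> 0 <= U ->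
  \sum_(i < n | wide B i) (J[B] (fun w => `|coord i 0 (V w)|) / pr B) `^ r <=
  (C_key * s * (1 + U / p)) `^ r.
Proof.
move=> cB prB U0; have B0 : 0 < pr B by rewrite prB expR_gt0.
have Up : 0 <= U / p by rewrite divr_ge0// ltW.
apply: lr_sum_duality => //.
- by rewrite !mulr_ge0// ?(ltW C_key_gt0) ?(ltW s0)// addr_ge0.
- by move=> i; rewrite divr_ge0 ?pr_ge0// J_ge0.
move=> v v0 hv; under eq_bigr do rewrite mulrA.
rewrite -mulr_suml ler_pdivrMr//.
apply: spread_sum_le => // u ule; apply: weak_bound; exact: hv.
Qed.

Definition cutoff (i : 'I_n) (w : T) : R :=
  `|X i w| `^ r * \1_[set w' | t * d i <= `|X i w'|] w.

Lemma cutoff_ge0 i w : 0 <= cutoff i w.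
Proof. by rewrite /cutoff mulr_ge0 ?powR_ge0. Qed.

Lemma cutoff_le i w : cutoff i w <= `|X i w| `^ r.
Proof. by rewrite /cutoff indicE ler_piMr ?powR_ge0// lern1 leq_b1. Qed.

Lemma measurable_cutoff i : measurable_fun setT (cutoff i).
Proof.
apply: measurable_funM.
  apply: (measurableT_comp (f := fun x => x `^ r)) => //.
  exact: measurableT_comp.
apply: measurable_indic; rewrite -[X in measurable X]setTI.
apply: measurable_fun_le => //; exact: measurableT_comp.
Qed.

Lemma coordV i w : coord i 0 (V w) = X i w.
Proof. by rewrite coordE subr0 mxE. Qed.

(** The layers have width [h]. The bottom one costs [c0], since there only the threshold matters.
    Each higher one is split into the half-spaces on either side, because [hg] speaks of cells.
    Borell's lemma at level [a0] makes their mass decay, and [hg] keeps half of the exponent. *)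
Lemma integral_cutoff_le B i (h c0 a0 C q F : R) (g : T -> \bar R) :
  cell B -> 0 < a0 -> a0 <= h -> 0 <= c0 ->
  (forall w, `|X i w| < h -> cutoff i w <= c0) ->
  pr (tail B (delta_mx 0 i) 0 a0) <= expR (- 1) * pr B ->
  measurable_fun setT g -> (forall w, 0 <= g w)%E -> 0 <= F ->
  (forall B' (e : R), cell B' -> B' `<=` B -> pr B' <= expR (- e) * pr B ->
     (\int[P]_(w in V @^-1` B') g w <= (expR (- (e / 2)) * F)%:E)%E) ->
  0 <= C -> 0 <= q < 1 ->
  (forall k, (k.+2%:R * h) `^ r * (2 * expR (- ((k.+1%:R * h / a0 - 1) / 8))) <=
     C * q ^+ k) ->
  (\int[P]_(w in V @^-1` B) ((cutoff i w)%:E * g w) <=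
    ((c0 + C / (1 - q)) * F)%:E)%E.
Proof.
move=> cB a00 a0h c00 hsmall htail mg g0 F0 hg C0 q01 hC; have [sB _] := cB.
have h0 : 0 < h by exact: lt_le_trans a0h.
pose E k := V @^-1` [set x | k%:R * h <= `|coord i 0 x|].
have mE k : measurable (E k).
  apply: sigma_compact_measurable; rewrite -[X in sigma_compact X]setTI.
  by apply: sigma_compact_tail; case: cellT.
(* Layer [k] is used for points with [|X i w|] between [k * h] and [(k + 1) * h], hence the shift in
   [k.+1]. *)
pose ck (k : nat) := if k is 0 then c0 else (k.+1%:R * h) `^ r.
have ck0 k : 0 <= ck k by case: k => //= k; exact: powR_ge0.
apply: le_trans (@integral_layers_le R disp T P (V @^-1` B) E (cutoff i) g ck
  (sigma_compact_measurable sB) mE _ (cutoff_ge0 i) _ g0 ck0 _) _.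
- exact/measurable_funTS/measurable_cutoff.
- exact: measurable_funTS.
- move=> w _; exists (Num.truncn (`|X i w| / h)).
    by rewrite /E /= coordV -ler_pdivlMr// truncn_le// divr_ge0// ltW.
  have : `|X i w| < (Num.truncn (`|X i w| / h)).+1%:R * h.
    by rewrite -ltr_pdivrMr// truncnS_gt.
  case: (Num.truncn _) => [|k] /= wk; first by apply: hsmall; rewrite mul1r in wk.
  apply: le_trans (cutoff_le i w) _; apply: ge0_ler_powR; rewrite ?nnegrE//.
  - exact: ltW.
  - by rewrite mulr_ge0// ltW.
  - exact: ltW.
rewrite mulrDl -[C / (1 - q) * F]mulrAC.
apply: nneseries_geometric_le1 => //; first exact: mulr_ge0.
- by move=> k; apply: mule_ge0; rewrite ?lee_fin//; exact: integral_ge0.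
- rewrite EFinM; apply: lee_wpmul2l; first by rewrite lee_fin.
  rewrite -preimage_setI (_ : B `&` _ = B); last first.
    by apply/seteqP; split => [x []//|x Bx]; split => //=; rewrite mul0r.
  have := hg B 0 cB; rewrite mul0r oppr0 expR0 !mul1r; apply => //.
move=> k; set e := (k.+1%:R * h / a0 - 1) / 4.
have y1 : 1 <= k.+1%:R * h / a0.
  rewrite ler_pdivlMr// mul1r; apply: (le_trans a0h).
  by rewrite ler_peMl// ?ler1n// ltW.
have tl : pr (tail B (delta_mx 0 i) 0 (k.+1%:R * h)) <= expR (- e) * pr B.
  have := pr_tail_le cB a00 (lexx 1) y1 htail.
  by rewrite divfK ?gt_eqF// mul1r.
set b := k.+1%:R * h in tl *.
have half B' : cell B' -> B' `<=` tail B (delta_mx 0 i) 0 b ->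
    (\int[P]_(w in V @^-1` B') g w <= (expR (- (e / 2)) * F)%:E)%E.
  move=> cB' sub; apply: hg => //; first by move=> x /sub[].
  apply: le_trans tl; apply: le_pr => //; first by case: cB'.
  exact: sigma_compact_tail.
have b0 : 0 < b by rewrite mulr_gt0.
pose Bp := B `&` [set x | b <= coord i 0 x].
pose Bm := B `&` [set x | coord i 0 x <= - b].
have cBp : cell Bp by apply: cellI => //; exact: cell_affine_ge.
have cBm : cell Bm by apply: cellI => //; exact: cell_affine_le.
have TE : V @^-1` B `&` E k.+1 = V @^-1` Bp `|` V @^-1` Bm.
  apply/seteqP; split => [w [Bw /= bw]|w [[Bw /= bw]|[Bw /= bw]]].
  - have {}bw : b <= `|coord i 0 (V w)| := bw.
    have [c0'|c0'] := leP 0 (coord i 0 (V w)).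
      by left; split => //=; move: bw; rewrite ger0_norm.
    by right; split => //=; move: bw; rewrite ltr0_norm// lerNr.
  - by split => //; rewrite /E /= -/b; apply: le_trans bw _; exact: ler_norm.
  - by split => //; rewrite /E /= -/b ler_normr [X in _ || X]lerNr bw orbT.
have [sBp _] := cBp; have [sBm _] := cBm.
rewrite TE ge0_integral_setU//=; last 4 first.
- exact: sigma_compact_measurable.
- exact: sigma_compact_measurable.
- exact: measurable_funTS.
- apply/disj_setPS => w [[_ /= w1] [_ /= w2]].
  by have := le_trans w1 w2; rewrite leNgt; lra.
apply: (@le_trans _ _ (((k.+2%:R * h) `^ r)%:E *
    ((expR (- (e / 2)) * F)%:E + (expR (- (e / 2)) * F)%:E))%E).
  apply: lee_wpmul2l; first by rewrite lee_fin powR_ge0.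
  apply: leeD; apply: half => // x [Bx /= bx]; split => //=.
    by apply: le_trans bx _; exact: ler_norm.
  by rewrite ler_normr [X in _ || X]lerNr bx orbT.
rewrite -EFinD -EFinM lee_fin [leRHS]mulrAC.
apply: le_trans (ler_wpM2r F0 (hC k)).
rewrite le_eqVlt; apply/orP; left; apply/eqP.
have -> : e / 2 = (k.+1%:R * h / a0 - 1) / 8 by rewrite /e; lra.
ring.
Qed.

Lemma tail_of_mean B i (a : R) : cell B -> 0 < a ->
  J[B] (fun w => `|coord i 0 (V w)|) <= a / 4 * pr B ->
  pr (tail B (delta_mx 0 i) 0 a) <= expR (- 1) * pr B.
Proof.
move=> [sB _] a0 h; have := markov_affine (delta_mx 0 i) 0 sB a0.
move=> /le_trans/(_ h); rewrite mulrAC -mulrA ler_pM2l// => h1.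
by have := expRN1_ge R; have := pr_ge0 B; nra.
Qed.

Lemma expR_eighth_le2 : expR (1 / 8) <= 2 :> R.
Proof.
rewrite -[expR _]invrK -expRN -[leRHS]invrK lef_pV2 ?posrE ?expR_gt0//.
by apply: le_trans (expR_ge1Dx _); lra.
Qed.

Section Coordinate.
Context (B : set 'rV[R]_n) (i : 'I_n) (F : R) (g : T -> \bar R).
Context (cB : cell B) (B0 : 0 < pr B) (mg : measurable_fun setT g)
  (g0 : forall w, (0 <= g w)%E) (F0 : 0 <= F).
Context (hg : forall B' (e : R), cell B' -> B' `<=` B -> pr B' <= expR (- e) * pr B ->
     (\int[P]_(w in V @^-1` B') g w <= (expR (- (e / 2)) * F)%:E)%E).

(** With [a] the mean of [|X_i|] on [B], Markov allows layers of width [4 * a]. The growth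
    [k.+2%:R]^ r[is absorbed by half of the decay]expR (- (k / 8))[, at the price of](16 * r)
    [^ r]. *)
Lemma integral_cutoff_wide : wide B i ->
  (\int[P]_(w in V @^-1` B) ((cutoff i w)%:E * g w) <=
    (69 * (64 * r * (J[B] (fun w => `|coord i 0 (V w)|) / pr B)) `^ r * F)%:E)%E.
Proof.
have r1' := r1; move=> /andP[di wi]; set a := J[B] _ / pr B.
have aE : J[B] (fun w => `|coord i 0 (V w)|) = a * pr B by rewrite divfK// gt_eqF.
have a0 : 0 < a.
  rewrite divr_gt0//; apply: le_lt_trans wi.
  by rewrite !mulr_ge0 ?pr_ge0 ?(ltW gap_gt0)// ltW.
clearbody a; have h0 : 0 < 4 * a by rewrite mulr_gt0.
have H0 : 0 <= (16 * r * (4 * a)) `^ r by exact: powR_ge0.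
have q1 : expR (- (1 / 16)) <= 16 / 17 :> R.
  rewrite expRN -[leRHS]invrK lef_pV2 ?posrE ?expR_gt0//.
  by apply: le_trans (expR_ge1Dx _); lra.
have q0 := expR_ge0 (- (1 / 16) : R).
apply: le_trans (integral_cutoff_le (h := 4 * a) (c0 := (4 * a) `^ r) (a0 := 4 * a)
  (C := 4 * (16 * r * (4 * a)) `^ r) (q := expR (- (1 / 16)))
  cB h0 (lexx _) (powR_ge0 _ _) _ _ mg g0 F0 hg _ _ _) _.
- move=> w wh; apply: le_trans (cutoff_le i w) _.
  by apply: ge0_ler_powR; rewrite ?nnegrE// ltW.
- by apply: tail_of_mean => //; rewrite aE; lra.
- exact: mulr_ge0.
- by rewrite q0/=; lra.
- move=> k; rewrite mulfK ?gt_eqF//.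
  have sr : 0 <= 16 * r by rewrite mulr_ge0// ltW.
  rewrite powRM ?(ltW h0)// [(16 * r * _) `^ r]powRM ?(ltW h0)//.
  have sixteenth : 0 < 1 / 16 :> R by lra.
  have := powR_le_expR r0 sixteenth (ler0n R k.+2).
  rewrite (_ : r / (1 / 16) = 16 * r); last by field.
  move=> kr.
  rewrite [leRHS](_ : _ = (16 * r) `^ r * (4 * expR (- (1 / 16)) ^+ k) * (4 * a) `^ r);
    last by ring.
  rewrite mulrAC ler_wpM2r ?powR_ge0//.
  have e2 : 0 <= 2 * expR (- ((k.+1%:R - 1) / 8)) :> R by rewrite mulr_ge0// expR_ge0.
  apply: le_trans (ler_wpM2r e2 kr) _; rewrite -mulrA ler_wpM2l ?powR_ge0//.
  rewrite mulrCA -expRD -expRM_natl.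
  rewrite (_ : 1 / 16 * k.+2%:R + - ((k.+1%:R - 1) / 8) = 1 / 8 + k%:R * - (1 / 16));
    last by rewrite -[k.+2%:R]natr1 -[k.+1%:R]natr1; lra.
  rewrite expRD mulrA ler_wpM2r ?expR_ge0//.
  by have := expR_eighth_le2; lra.
rewrite lee_fin ler_wpM2r//.
have c0le : (4 * a) `^ r <= (16 * r * (4 * a)) `^ r.
  apply: ge0_ler_powR; rewrite ?nnegrE; [exact: ltW|exact: ltW| |].
    by rewrite !mulr_ge0// ltW.
  apply: ler_peMl; first exact: ltW.
  by lra.
rewrite (_ : 64 * r * a = 16 * r * (4 * a)); last by ring.
(* The geometric sum is at most 17, and [4 * 17 + 1 = 69] includes the bottom layer. *)
have : 4 * (16 * r * (4 * a)) `^ r / (1 - expR (- (1 / 16))) <=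
    4 * (16 * r * (4 * a)) `^ r * 17.
  rewrite ler_wpM2l ?mulr_ge0// -[leRHS]invrK lef_pV2 ?posrE//; lra.
lra.
Qed.

Lemma integral_cutoff_narrow (gp t' : R) : 0 < d i -> ~~ wide B i ->
  0 < gp -> gp = 64 * gap -> t <= t' -> 16 * r * gp <= t' ->
  (\int[P]_(w in V @^-1` B) ((cutoff i w)%:E * g w) <=
    (((if t < t' then (t' * d i) `^ r else 0) +
      8 * expR (- (t' / gp / 16)) * (t' * d i) `^ r) * F)%:E)%E.
Proof.
have r1' := r1.
move=> di; rewrite /wide di /= -leNgt => wi gp0 gpE tt' t'r.
pose tau := t' / gp.
have tauE : t' = tau * gp by rewrite /tau divfK// gt_eqF.
have tau16 : 16 * r <= tau by rewrite /tau ler_pdivlMr.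
rewrite -/tau; clearbody tau.
have tau0 : 0 < tau by lra.
have a0 : 0 < gp * d i by exact: mulr_gt0.
have h0 : 0 < t' * d i by rewrite tauE !mulr_gt0.
pose x := expR (- (tau / 16)).
have x0 : 0 <= x by exact: expR_ge0.
have x1 : x <= 2^-1.
  rewrite /x expRN lef_pV2 ?posrE ?expR_gt0//.
  by apply: le_trans (expR_ge1Dx _); lra.
have hr0 : 0 <= (t' * d i) `^ r by exact: powR_ge0.
rewrite -/x.
apply: le_trans (integral_cutoff_le (h := t' * d i)
  (c0 := if t < t' then (t' * d i) `^ r else 0) (a0 := gp * d i)
  (C := 4 * (t' * d i) `^ r * x) (q := x)
  cB a0 _ _ _ _ mg g0 F0 hg _ _ _) _.
- by rewrite ler_wpM2r ?(ltW di)// tauE ler_peMl ?(ltW gp0)//; lra.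
- by case: ifP.
(* If [t' <= t], the bottom layer lies below the threshold and the cut-off vanishes on it. *)
- move=> w wh; case: ltP => [_|t't].
    apply: le_trans (cutoff_le i w) _.
    by apply: ge0_ler_powR; rewrite ?nnegrE ?(ltW h0) ?(ltW wh)// ltW.
  rewrite /cutoff indicE memNset ?mulr0//= => /le_lt_trans/(_ wh).
  by rewrite ltr_pM2r// ltNge t't.
- apply: tail_of_mean => //; apply: (le_trans wi).
  by rewrite ler_wpM2r ?pr_ge0// gpE; lra.
- by rewrite !mulr_ge0.
- by rewrite x0/=; lra.
- move=> k.
  have -> : k.+1%:R * (t' * d i) / (gp * d i) = k.+1%:R * tau.
    by rewrite tauE; field; rewrite !gt_eqF.
  rewrite powRM ?(ltW h0)//.
  have kr : k.+2%:R `^ r <= expR (r * k.+1%:R).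
    apply: (@le_trans _ _ (expR k.+1%:R `^ r)).
      apply: ge0_ler_powR; rewrite ?nnegrE ?expR_ge0 ?(ltW r0)//.
      by apply: le_trans (expR_ge1Dx _); rewrite -[k.+2%:R]natr1 addrC.
    by rewrite /powR gt_eqF ?expR_gt0// expRK.
  rewrite [leLHS](_ : _ = (k.+2%:R `^ r * (2 * expR (- ((k.+1%:R * tau - 1) / 8)))) *
    (t' * d i) `^ r); last by ring.
  rewrite [leRHS](_ : _ = (4 * x ^+ k.+1) * (t' * d i) `^ r); last by rewrite exprS; ring.
  rewrite ler_wpM2r//.
  have e2 : 0 <= 2 * expR (- ((k.+1%:R * tau - 1) / 8)) by rewrite mulr_ge0// expR_ge0.
  apply: le_trans (ler_wpM2r e2 kr) _; rewrite mulrCA -expRD /x -expRM_natl.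
  have k0 : 0 <= k.+1%:R :> R by [].
  apply: (@le_trans _ _ (2 * expR (1 / 8 + k.+1%:R * - (tau / 16)))).
    rewrite ler_pM2l// ler_expR.
    have : k.+1%:R * (16 * r) <= k.+1%:R * tau by rewrite ler_wpM2l.
    lra.
  rewrite expRD mulrA ler_wpM2r ?expR_ge0//.
  by have := expR_eighth_le2; lra.
rewrite lee_fin ler_wpM2r// lerD2l.
rewrite [leRHS](_ : _ = 4 * (t' * d i) `^ r * x * 2); last by ring.
rewrite ler_wpM2l ?mulr_ge0//.
by rewrite -[leRHS]invrK lef_pV2 ?posrE//; lra.
Qed.
End Coordinate.

Definition C_gap : R := locked (64 * gap).

Lemma C_gap_gt0 : 0 < C_gap.
Proof. by have := gap_gt0; rewrite /C_gap -lock; move: gap => e e0; rewrite mulr_gt0. Qed.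

Lemma C_gapE : C_gap = 64 * gap.
Proof. by rewrite /C_gap -lock. Qed.

Definition C_step : R := locked (4 * 78 * 64 * (C_key + C_gap)).

Lemma C_step_gt0 : 0 < C_step.
Proof.
have := C_key_gt0; have := C_gap_gt0; rewrite /C_step -lock.
by move: C_key C_gap => a b a0 b0; rewrite !mulr_gt0// addr_gt0.
Qed.

Section Combine.
(* [t'] is the maximum of [t] and [16 * r * C_gap]. *)
Context (t' : R) (tt' : t <= t') (t'r : 16 * r * C_gap <= t').
Context (t'E : t < t' -> t' = 16 * r * C_gap).
Context (hd : \sum_(i < n | 0 < d i) d i `^ r <=
  (s * expR (t' / (32 * C_gap * r))) `^ r).

Lemma ler_powR_r (x y : R) : 0 <= x -> x <= y -> x `^ r <= y `^ r.
Proof.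
move=> x0 xy; apply: ge0_ler_powR; rewrite ?nnegrE//; [exact: ltW|exact: le_trans xy].
Qed.

Lemma narrow_sum_le :
  \sum_(i < n | 0 < d i) ((if t < t' then (t' * d i) `^ r else 0) +
     8 * expR (- (t' / C_gap / 16)) * (t' * d i) `^ r) <=
  9 * (64 * C_gap * r * s) `^ r.
Proof.
have r1' := r1; have r0' := r0; have s0' := s0.
have gp0 := C_gap_gt0; have tr := t'r; have te := t'E; have hdd := hd.
have t0 : 0 < t' by apply: lt_le_trans tr; rewrite !mulr_gt0//; lra.
move: C_gap gp0 tr te hdd => gp gp0 tr te hdd.
pose x := expR (- (t' / gp / 16)).
have x0 : 0 <= x by exact: expR_ge0.
set dr := \sum_(i < n | 0 < d i) d i `^ r in hdd *.
have E i : 0 < d i -> (if t < t' then (t' * d i) `^ r else 0) +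
     8 * x * (t' * d i) `^ r = ((if t < t' then t' `^ r else 0) + 8 * x * t' `^ r) * d i `^ r.
  by move=> di; rewrite !powRM ?(ltW di) ?(ltW t0)//; case: ifP => _; ring.
rewrite (eq_bigr (fun i => ((if t < t' then t' `^ r else 0) + 8 * x * t' `^ r) * d i `^ r)) //.
rewrite -mulr_sumr -/dr mulrDl.
have dr0 : 0 <= dr by apply: sumr_ge0 => i _; exact: powR_ge0.
have e0 := expR_ge0 (t' / (32 * gp * r)).
have M0 : 0 <= (64 * gp * r * s) `^ r by exact: powR_ge0.
have first : (if t < t' then t' `^ r else 0) * dr <= (64 * gp * r * s) `^ r.
  case: ifP => [/te tE|_]; last by rewrite mul0r.
  apply: le_trans (ler_wpM2l (powR_ge0 _ _) hdd) _.
  rewrite -powRM ?(ltW t0)//; last by rewrite mulr_ge0// ltW.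
  apply: ler_powR_r; first by rewrite !mulr_ge0// ltW.
  have -> : t' / (32 * gp * r) = 2^-1 by rewrite tE; field; rewrite !gt_eqF.
  have e4 : expR 2^-1 <= 4 :> R.
    by apply: le_trans (expR1_le4 R); rewrite ler_expR; lra.
  rewrite tE [leRHS](_ : _ = 16 * r * gp * (s * 4)); last by ring.
  rewrite ler_wpM2l//; first by rewrite !mulr_ge0// ltW.
  by rewrite ler_wpM2l// ltW.
have second : x * t' `^ r * dr <= (64 * gp * r * s) `^ r.
  apply: (@le_trans _ _ (x * t' `^ r * (s * expR (t' / (32 * gp * r))) `^ r)).
    by rewrite ler_wpM2l// mulr_ge0// powR_ge0.
  have -> : (s * expR (t' / (32 * gp * r))) `^ r = s `^ r * expR (t' / gp / 32).
    rewrite powRM ?(ltW s0')// [X in _ * X]/powR gt_eqF ?expR_gt0// expRK.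
    by congr (_ * expR _); field; rewrite !gt_eqF.
  pose tau := t' / gp.
  have tau0 : 0 < tau by rewrite divr_gt0.
  have -> : t' `^ r = tau `^ r * gp `^ r.
    by rewrite -powRM ?(ltW tau0) ?(ltW gp0)// divfK// gt_eqF.
  have h32 : 0 < 1 / 32 :> R by lra.
  have := powR_le_expR r0' h32 (ltW tau0).
  rewrite (_ : r / (1 / 32) = 32 * r); last by field.
  move=> htau.
  apply: (@le_trans _ _ (x * ((32 * r) `^ r * expR (1 / 32 * tau) * gp `^ r) *
      (s `^ r * expR (tau / 32)))).
    rewrite ler_wpM2r ?mulr_ge0 ?powR_ge0 ?expR_ge0//.
    by rewrite ler_wpM2l// ler_wpM2r ?powR_ge0.
  rewrite [leLHS](_ : _ = (x * expR (1 / 32 * tau) * expR (tau / 32)) *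
    ((32 * r) `^ r * gp `^ r * s `^ r)); last by ring.
  rewrite /x -!expRD (_ : - (t' / gp / 16) + 1 / 32 * tau + tau / 32 = 0); last first.
    by rewrite -/tau; lra.
  have r32 : 0 <= 32 * r by lra.
  rewrite expR0 mul1r -!powRM ?mulr_ge0 ?(ltW gp0) ?(ltW s0') ?(ltW r0')//.
  apply: ler_powR_r; first by rewrite !mulr_ge0// ltW.
  have : 0 <= gp * r * s by rewrite !mulr_ge0// ltW.
  lra.
rewrite -/x; lra.
Qed.

Lemma integral_step B (N Dm : R) (g : T -> \bar R) :
  cell B -> 0 < pr B -> measurable_fun setT g -> (forall w, (0 <= g w)%E) ->
  0 <= N -> N <= 2 * p -> 0 <= Dm ->
  (forall B', cell B' -> (\int[P]_(w in V @^-1` B') g w <=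
     (Dm * mass_growth p N (pr B'))%:E)%E) ->
  (\int[P]_(w in V @^-1` B) (((\sum_(i < n | 0 < d i) cutoff i w)%R)%:E * g w) <=
    ((C_step * r * s) `^ r * Dm * mass_growth p (N + r) (pr B))%:E)%E.
Proof.
move=> cB B0 mg g0 N0 Np D0 hg; have [sB _] := cB.
have r1' := r1; have r0' := r0; have s0' := s0; have p0' := p0; have p1' := p1.
have B1 := pr_le1 sB.
pose U := - ln (pr B).
have U0 : 0 <= U by rewrite /U oppr_ge0 ln_le0.
have BU : pr B = expR (- U) by rewrite /U opprK lnK.
pose F := Dm * mass_growth p N (pr B).
have mg0 y M : 0 <= y -> 0 <= mass_growth p M y.
  by move=> y0; rewrite mulr_ge0// powR_ge0.
have F0 : 0 <= F by rewrite mulr_ge0// mg0// ltW.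
have hgB B' (e : R) : cell B' -> B' `<=` B -> pr B' <= expR (- e) * pr B ->
    (\int[P]_(w in V @^-1` B') g w <= (expR (- (e / 2)) * F)%:E)%E.
  move=> cB' sub hB'; apply: le_trans (hg _ cB') _.
  rewrite lee_fin /F [leRHS]mulrCA ler_wpM2l//.
  apply: mass_growth_le => //; first exact: pr_ge0.
  by apply: le_pr => //; case: cB'.
have distr w : (((\sum_(i < n | 0 < d i) cutoff i w)%R)%:E * g w =
    \sum_(i <- [seq i <- index_enum 'I_n | (0 < d i)%R]) (cutoff i w)%:E * g w)%E.
  by rewrite big_filter -sumEFin ge0_sume_distrl// => i _; rewrite lee_fin cutoff_ge0.
under eq_integral do rewrite distr.
rewrite ge0_integral_sum//; first rewrite big_filter; last 3 first.
- exact: sigma_compact_measurable.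
- move=> i; apply: emeasurable_funM; last exact: measurable_funTS.
  by apply/measurable_EFinP; apply: measurable_funTS; exact: measurable_cutoff.
- by move=> i w _; apply: mule_ge0; rewrite ?lee_fin ?cutoff_ge0.
pose bnd i : R := if wide B i then
    69 * (64 * r * (J[B] (fun w => `|coord i 0 (V w)|) / pr B)) `^ r else
    (if t < t' then (t' * d i) `^ r else 0) +
     8 * expR (- (t' / C_gap / 16)) * (t' * d i) `^ r.
apply: (@le_trans _ _ (\sum_(i < n | (0 < d i)%R) (bnd i * F)%:E)%E).
  apply: lee_sum => i di; rewrite /bnd; case: ifPn => wi.
    exact: integral_cutoff_wide.
  apply: integral_cutoff_narrow => //; [exact: C_gap_gt0|exact: C_gapE].
rewrite sumEFin lee_fin -mulr_suml.
have Up : 0 <= U / p by rewrite divr_ge0// ltW.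
have sumb : \sum_(i < n | 0 < d i) bnd i <= (C_step * r * s * (1 + U / (4 * p))) `^ r.
  have gp0 := C_gap_gt0; have ck0 := C_key_gt0.
  have hw := wide_powR_sum_le cB BU U0.
  have hn := narrow_sum_le.
  have hb : \sum_(i < n | 0 < d i) bnd i <=
     69 * (64 * r) `^ r * (C_key * s * (1 + U / p)) `^ r + 9 * (64 * C_gap * r * s) `^ r.
    rewrite (bigID (wide B)) /=; apply: lerD.
      apply: le_trans (ler_wpM2l _ hw); last by rewrite mulr_ge0// powR_ge0.
      rewrite mulr_sumr le_eqVlt; apply/orP; left; apply/eqP.
      apply: eq_big => [i|i /andP[_ wi]].
        by rewrite andb_idl// /wide => /andP[].
      rewrite /bnd wi powRM ?mulrA// ?divr_ge0 ?J_ge0 ?pr_ge0//; lra.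
    apply: le_trans hn; rewrite big_mkcondr; apply: ler_sum => i di.
    rewrite /bnd; have [wi|wi] := boolP (wide B i) => //=.
    by case: ifP => _; rewrite ?addr_ge0 ?mulr_ge0 ?powR_ge0 ?expR_ge0.
  apply: (le_trans hb); rewrite /C_step -lock.
  move: C_key C_gap gp0 ck0 {hw hn hb} => ck gp gp0 ck0.
  have y1 : 1 <= 1 + U / p by lra.
  set Y := 64 * (ck + gp) * r * s * (1 + U / p).
  have Y0 : 0 <= Y.
    by rewrite !mulr_ge0 ?(ltW r0') ?(ltW s0')// ?addr_ge0 ?(ltW ck0) ?(ltW gp0)//; lra.
  have rs0 : 0 < r * s by rewrite mulr_gt0.
  have a1 : 69 * (64 * r) `^ r * (ck * s * (1 + U / p)) `^ r <= 69 * Y `^ r.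
    have cs0 : 0 <= ck * s * (1 + U / p) by rewrite !mulr_ge0 ?ltW//; lra.
    rewrite -mulrA ler_wpM2l// -powRM//; last lra.
    apply: ler_powR_r; first by rewrite mulr_ge0//; lra.
    rewrite /Y (_ : 64 * r * (ck * s * (1 + U / p)) = 64 * ck * r * s * (1 + U / p)); last by ring.
    rewrite ler_wpM2r//; first lra.
    by rewrite -!mulrA ler_wpM2l// ler_wpM2r ?(ltW rs0)// lerDl ltW.
  have a2 : 9 * (64 * gp * r * s) `^ r <= 9 * Y `^ r.
    rewrite ler_wpM2l//; apply: ler_powR_r; first by rewrite !mulr_ge0// ltW.
    apply: (@le_trans _ _ (64 * (ck + gp) * r * s)).
      by rewrite -!mulrA ler_wpM2l// ler_wpM2r ?(ltW rs0)// lerDr ltW.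
    by rewrite /Y ler_peMr// !mulr_ge0// ?addr_ge0// ltW.
  (* Here [78 = 69 + 9] is moved inside the power, as [r >= 1]. The factor 4 of [C_step] then pays
     for replacing [1 + U / p] by [1 + U / (4 * p)]. *)
  apply: (@le_trans _ _ (78 * Y `^ r)); first lra.
  apply: (@le_trans _ _ (78 `^ r * Y `^ r)).
    rewrite ler_wpM2r ?powR_ge0//; apply: le1r_powR => //; lra.
  rewrite -powRM//; apply: ler_powR_r; first by rewrite mulr_ge0.
  have -> : 4 * 78 * 64 * (ck + gp) * r * s * (1 + U / (4 * p)) =
      78 * (64 * (ck + gp) * r * s * (4 + U / p)) by field; rewrite gt_eqF.
  rewrite ler_wpM2l// /Y ler_wpM2l//; last lra.
  by rewrite !mulr_ge0// ?addr_ge0// ltW.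
apply: le_trans (ler_wpM2r F0 sumb) _.
rewrite /F /mass_growth.
have u0 : 0 < 1 + U / (4 * p).
  by have : 0 <= U / (4 * p) by [rewrite divr_ge0// mulr_ge0// ltW|]; lra.
have -> : 1 - ln (pr B) / (4 * p) = 1 + U / (4 * p) by rewrite /U mulNr.
rewrite powRM ?(ltW u0)//; last by rewrite !mulr_ge0 ?(ltW C_step_gt0)// ltW.
rewrite powRD; last by rewrite (gt_eqF u0) implybT.
by rewrite le_eqVlt; apply/orP; left; apply/eqP; ring.
Qed.

(** Coordinates with [d i = 0] are left out, since the estimates are relative to [d i];
    [cutoff_sum_ae] restores them. *)
Definition cutoff_sum (w : T) : R := \sum_(i < n | 0 < d i) cutoff i w.

Lemma cutoff_sum_ge0 w : 0 <= cutoff_sum w.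
Proof. by apply: sumr_ge0 => i _; exact: cutoff_ge0. Qed.

Lemma measurable_cutoff_sum : measurable_fun setT cutoff_sum.
Proof.
rewrite /cutoff_sum; under eq_fun do rewrite -big_filter.
by apply: measurable_sum => i; exact: measurable_cutoff.
Qed.

(** The induction runs over all cells at once, as the step passes to smaller ones. The condition on
    [m] keeps the exponent before the last step at most [2 * p], as in [mass_growth_le]. *)
Lemma integral_cutoff_sum_exp m B : r * m%:R <= 2 * p + r -> cell B ->
  (\int[P]_(w in V @^-1` B) (cutoff_sum w ^+ m)%:E <=
    (((C_step * r * s) `^ r) ^+ m * mass_growth p (r * m%:R) (pr B))%:E)%E.
Proof.
have r0' := r0; have p0' := p0.
elim: m B => [|m ih] B hm cB; have [sB _] := cB.
  under eq_integral do rewrite expr0.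
  by rewrite integral_cst_pr// !mul1r mulr0 /mass_growth powRr0 mulr1.
have hm' : r * m%:R <= 2 * p by move: hm; rewrite -[m.+1%:R]natr1; lra.
have mW k : measurable_fun setT (fun w => (cutoff_sum w ^+ k)%:E).
  by apply/measurable_EFinP; apply: measurable_funX; exact: measurable_cutoff_sum.
(* On a null cell there is no logarithm of the mass to work with, but both sides are 0. *)
have [B0|B0] := eqVneq (pr B) 0.
  rewrite /mass_growth B0 mul0r mulr0 null_set_integral//.
  - exact: sigma_compact_measurable.
  - exact: measurable_funTS.
  - by have := pr_fineK sB; rewrite B0 => /esym.
under eq_integral do rewrite exprS EFinM.
apply: le_trans (integral_step (N := r * m%:R) (Dm := ((C_step * r * s) `^ r) ^+ m)
  cB _ (mW m) _ _ hm' _ _) _.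
- by rewrite lt_neqAle eq_sym B0 pr_ge0.
- by move=> w; rewrite lee_fin exprn_ge0// cutoff_sum_ge0.
- by rewrite mulr_ge0// ltW.
- by rewrite exprn_ge0// powR_ge0.
- by move=> B' cB'; apply: ih => //; lra.
rewrite lee_fin exprS le_eqVlt; apply/orP; left; apply/eqP.
by congr (_ * mass_growth _ _ _); rewrite -[m.+1%:R]natr1; ring.
Qed.

Lemma integral_cutoff_sum_powR :
  (\int[P]_w (cutoff_sum w `^ (p / r))%:E <= ((2 * C_step * r * s) `^ p)%:E)%E.
Proof.
have r0' := r0; have p0' := p0; have p1' := p1; have s0' := s0.
have c0 := C_step_gt0; have [sT _] := cellT.
have a0 : 0 <= p / r by rewrite divr_ge0// ltW.
pose l := (Num.truncn (p / r)).+1.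
have al : p / r <= l%:R by rewrite ltW// truncnS_gt.
have la : r * l%:R <= 2 * p + r.
  have : l%:R <= p / r + 1 by rewrite /l -natr1 lerD2r truncn_le.
  move=> /(ler_wpM2l (ltW r0')) /le_trans; apply.
  by rewrite mulrDr mulrCA divff ?gt_eqF//; lra.
pose D := (C_step * r * s) `^ r.
have D0 : 0 < D by apply: powR_gt0; rewrite !mulr_gt0.
have h := integral_cutoff_sum_exp la cellT.
rewrite preimage_setT pr_setT /mass_growth ln1 mul0r subr0 powR1 !mulr1 -/D in h.
have mW : measurable_fun setT (fun w => (cutoff_sum w ^+ l)%:E).
  by apply/measurable_EFinP; apply: measurable_funX; exact: measurable_cutoff_sum.
have pointwise w : cutoff_sum w `^ (p / r) <=
    D `^ (p / r) + D `^ (p / r) / D ^+ l * cutoff_sum w ^+ l.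
  have W0 := cutoff_sum_ge0 w; move: (cutoff_sum w) W0 => x x0.
  pose y := x / D; have y0 : 0 <= y by rewrite divr_ge0// ltW.
  have -> : x = D * y by rewrite /y mulrC divfK// gt_eqF.
  rewrite powRM ?(ltW D0)// exprMn mulrA divfK ?gt_eqF ?exprn_gt0//.
  rewrite -[X in X + _]mulr1 -mulrDr ler_wpM2l ?powR_ge0//.
  have [y1|y1] := leP y 1.
    apply: (@le_trans _ _ 1); last by rewrite lerDl exprn_ge0.
    apply: (@le_trans _ _ (1 `^ (p / r))); last by rewrite powR1.
    by apply: ge0_ler_powR; rewrite ?nnegrE.
  rewrite -powR_mulrn//; apply: (@le_trans _ _ (y `^ l%:R)); last by rewrite lerDr.
  by apply: ler_powR => //; exact: ltW.
have k0 : 0 <= D `^ (p / r) / D ^+ l by rewrite divr_ge0 ?powR_ge0 ?exprn_ge0// ltW.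
apply: (@le_trans _ _ (\int[P]_w ((D `^ (p / r))%:E +
    (D `^ (p / r) / D ^+ l)%:E * (cutoff_sum w ^+ l)%:E))%E).
  apply: ge0_le_integral => //.
  - by move=> w _; rewrite lee_fin powR_ge0.
  - apply/measurable_EFinP; apply: (measurableT_comp (f := fun x => x `^ (p / r))) => //.
    exact: measurable_cutoff_sum.
  - by apply: emeasurable_funD => //; exact: measurable_funeM.
  - by move=> w _; rewrite -EFinM -EFinD lee_fin.
have Wl0 w : (0 <= (cutoff_sum w ^+ l)%:E)%E.
  by rewrite lee_fin exprn_ge0// cutoff_sum_ge0.
rewrite ge0_integralD//; last 3 first.
- by move=> w _; rewrite lee_fin powR_ge0.
- by move=> w _; apply: mule_ge0.
- exact: measurable_funeM.
have := integral_cst_pr (D `^ (p / r)) sT.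
rewrite preimage_setT pr_setT mulr1 => ->; rewrite ge0_integralZl_EFin//.
apply: (@le_trans _ _ ((D `^ (p / r))%:E + (D `^ (p / r) / D ^+ l)%:E * (D ^+ l)%:E)%E).
  by apply: leeD => //; apply: lee_wpmul2l => //; rewrite lee_fin.
rewrite -EFinM -EFinD lee_fin divfK ?gt_eqF ?exprn_gt0//.
have -> : D `^ (p / r) = (C_step * r * s) `^ p.
  by rewrite /D -powRrM [r * _]mulrC divfK// gt_eqF.
rewrite -[2 * C_step * r * s](_ : 2 * (C_step * r * s) = _); last by ring.
rewrite (@powRM _ 2 (C_step * r * s))//; last by rewrite !mulr_ge0// ltW.
have : 2 <= 2 `^ p :> R by apply: le1r_powR => //; lra.
have : 0 <= (C_step * r * s) `^ p by exact: powR_ge0.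
nra.
Qed.

End Combine.
End Step.
End GoodCells.

Lemma affineZ (x : R) v (y : 'rV[R]_n) : affine (x *: v) 0 y = x * affine v 0 y.
Proof.
by rewrite /affine !subr0 mulr_sumr; apply: eq_bigr => i _; rewrite mxE mulrA.
Qed.

(** * Weak moments *)

Lemma J_sqr_coord i : J[setT] (fun w => coord i 0 (V w) ^+ 2) = coord_L2 X i ^+ 2.
Proof.
rewrite /coord_L2 unlock /Rintegral preimage_setT.
under eq_integral do rewrite coordV.
rewrite powR12_sqrt ?sqr_sqrtr//.
  by apply: fine_ge0; apply: integral_ge0 => w _; rewrite lee_fin sqr_ge0.
by apply: fine_ge0; apply: integral_ge0 => w _; rewrite lee_fin sqr_ge0.
Qed.

(** The supremum is finite, by a bound uniform over the dual ball, so that [fine] does not replace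
    it by a default value. *)
Lemma weak_moment_bound (r p : R) u : 1 <= r -> r <= p ->
  lq_norm (hoelder_conjugate r%:E) u <= 1 ->
  moment_bound p (fine (weak_moment r X p)) u.
Proof.
move=> r1 rp u1; have p0 : 0 < p by lra.
have [sT _] := cellT.
pose E v := (\int[P]_w (`|affine v 0 (V w)| `^ p)%:E)%E.
have scale_coord w i : n%:R * X i w = affine (n%:R *: delta_mx 0 i) 0 (V w).
  by rewrite affineZ -[affine _ _ _]/(coord i 0 (V w)) coordV.
have Eint v := integrable_powR_affine v 0 p0.
have EE v : E v = (J[setT] (fun w => `|affine v 0 (V w)| `^ p))%:E.
  by rewrite JE// preimage_setT.
have EX v : 'E_P[fun w => (`|\sum_(i < n) v 0 i * X i w| `^ p)%R]%E = E v.
  rewrite unlock; apply: eq_integral => w _; rewrite /affine subr0.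
  by under [in RHS]eq_bigr do rewrite mxE.
have E0 v : 0 <= J[setT] (fun w => `|affine v 0 (V w)| `^ p).
  by apply: J_ge0 => w; exact: powR_ge0.
pose B := \sum_(i < n) J[setT] (fun w => `|affine (n%:R *: delta_mx 0 i) 0 (V w)| `^ p).
have EB v : lq_norm (hoelder_conjugate r%:E) v <= 1 ->
    J[setT] (fun w => `|affine v 0 (V w)| `^ p) <= B.
  move=> v1; rewrite -lee_fin /B -EE -sumEFin.
  under eq_bigr do rewrite -EE.
  rewrite -ge0_integral_sum//; last first.
    by move=> i; exact: measurable_int (Eint (n%:R *: delta_mx 0 i)).
  apply: ge0_le_integral => //.
  - exact: measurable_int (Eint v).
  - apply: emeasurable_sum => i.
    exact: measurable_int (Eint (n%:R *: delta_mx 0 i)).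
  move=> w _; rewrite sumEFin lee_fin.
  rewrite {1}/affine subr0; under eq_bigr do rewrite mxE.
  under [leRHS]eq_bigr do rewrite -scale_coord.
  by apply: powR_norm_sum_le => // i; exact: lq_norm_hoelder_conjugate_coord r1 v1.
have W : (weak_moment r X p <= (B `^ p^-1)%:E)%E.
  apply: ge_ereal_sup => _ [v v1 <-]; rewrite EX EE poweR_EFin lee_fin.
  by apply: ge0_ler_powR; rewrite ?invr_ge0 ?nnegrE ?(ltW p0)//; [apply: le_trans (EB v v1)|exact: EB].
have W0 : (poweR (E u) p^-1 <= weak_moment r X p)%E.
  by apply: ereal_sup_ubound; exists u => //; rewrite EX.
rewrite EE poweR_EFin in W0.
have Wf : (fine (weak_moment r X p))%:E = weak_moment r X p.
  rewrite fineK// fin_numE; apply/andP; split.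
    by rewrite gt_eqF// (lt_le_trans _ W0)// ltNyr.
  by rewrite lt_eqF// (le_lt_trans W)// ltry.
rewrite -Wf lee_fin in W0.
rewrite /moment_bound -[leLHS]powRr1// -(mulVf (lt0r_neq0 p0)) powRrM.
apply: ge0_ler_powR; rewrite ?nnegrE ?powR_ge0 ?(ltW p0)//.
exact: le_trans (powR_ge0 _ _) W0.
Qed.

Lemma coord_L2_ge0 i : 0 <= coord_L2 X i.
Proof. exact: powR_ge0. Qed.

Lemma coord_L2_eq0 i : coord_L2 X i = 0 -> {ae P, forall w, X i w = 0}.
Proof.
move=> i0; have [sT _] := cellT.
have iX := integrable_sqr_affine (delta_mx 0 i) 0.
have : (\int[P]_w `|(coord i 0 (V w) ^+ 2)%:E| = 0)%E.
  under eq_integral do rewrite gee0_abs ?lee_fin ?sqr_ge0//.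
  have := JE sT iX; rewrite -[X in X%:E]/(J[setT] (fun w => coord i 0 (V w) ^+ 2)).
  by rewrite J_sqr_coord i0 expr0n preimage_setT => <-.
move/ae_eq_integral_abs => /(_ measurableT (measurable_int _ iX)).
apply: filterS => w /(_ I) /= [] /eqP; rewrite sqrf_eq0 coordV.
by move/eqP.
Qed.

Lemma coord_L2_le (p s : R) i : 1 <= p -> 0 < s -> moment_bound p s (delta_mx 0 i) ->
  coord_L2 X i ^+ 2 <= C_sqr * (8 * expR 1 * s / p * (ln 9 + p)) ^+ 2.
Proof.
move=> p1 s0 hs; have p0 : 0 < p by lra.
have ln90 : 0 < ln 9 :> R by rewrite ln_gt0//; lra.
have := @sqr_moment_le setT (delta_mx 0 i) 0 (8 * expR 1 * s / p * (ln 9 + p)) cellT.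
rewrite pr_setT !mulr1 -J_sqr_coord; apply.
  by rewrite !mulr_gt0 ?invr_gt0 ?expR_gt0 ?addr_gt0.
have := @mean_bound setT p s 0 (delta_mx 0 i) cellT p1 s0 hs.
by rewrite pr_setT oppr0 expR0 mulr1 addr0; exact.
Qed.

(** If the weak moment vanished, [coord_L2_le] would apply with every [s > 0] and bound the second
    moment of [X_i] by a fixed multiple of [s ^+ 2]. *)
Lemma weak_moment_gt0 (r p : R) i : 1 <= r -> r <= p -> 0 < coord_L2 X i ->
  0 < fine (weak_moment r X p).
Proof.
move=> r1 rp d0; have p1 : 1 <= p by lra.
have u1 := lq_norm_delta_le1 i r1.
rewrite lt_neqAle; apply/andP; split; last first.
  apply: fine_ge0; apply: le_ereal_sup_tmp; eexists; first by exists (delta_mx 0 i).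
  exact: poweR_ge0.
apply/eqP => W0; have := weak_moment_bound r1 rp u1; rewrite -W0 => h.
have hs (s : R) : 0 < s -> moment_bound p s (delta_mx 0 i).
  move=> s0; apply: le_trans h _; rewrite powR0 ?powR_ge0//.
  by rewrite gt_eqF//; lra.
pose K : R := 8 * expR 1 / p * (ln 9 + p).
pose C := C_sqr * K ^+ 2.
have C0 : 0 <= C by rewrite mulr_ge0 ?sqr_ge0// ltW// C_sqr_gt0.
pose s := coord_L2 X i / (C + 1).
have C1 : 0 < C + 1 by lra.
have s0 : 0 < s by rewrite divr_gt0.
have := coord_L2_le p1 s0 (hs _ s0).
rewrite -[8 * expR 1 * s / p * _](_ : K * s = _); last by rewrite /K; ring.
have dE : coord_L2 X i = s * (C + 1) by rewrite /s divfK// gt_eqF.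
rewrite exprMn mulrA -/C dE exprMn mulrC leNgt; move/negP; apply.
rewrite ltr_pM2r ?exprn_gt0//; nra.
Qed.

(** * Coordinates of zero second moment and choice of the threshold *)

Lemma cutoff_sum_ae (r t : R) : 0 < r ->
  {ae P, forall w, \sum_(i < n) cutoff (coord_L2 X) r t i w =
                   cutoff_sum (coord_L2 X) r t w}.
Proof.
move=> r0.
have : {ae P, forall w, forall i, coord_L2 X i = 0 -> X i w = 0}.
  apply: filter_forall => i.
  have [/coord_L2_eq0|i0] := eqVneq (coord_L2 X i) 0.
    by apply: filterS => w.
  by apply: nearW => w i0'; rewrite i0' eqxx in i0.
apply: filterS => w h; rewrite /cutoff_sum [RHS]big_mkcond; apply: eq_bigr => i _.
case: ifPn => // i0; apply/eqP; rewrite eq_le cutoff_ge0 andbT.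
have := cutoff_le (coord_L2 X) r t i w.
rewrite h ?normr0 ?powR0 ?gt_eqF//.
by apply/eqP; rewrite eq_le coord_L2_ge0 leNgt i0.
Qed.

(** If all [coord_L2 X i] vanish, the sum is almost surely 0. Otherwise the weak moment is positive,
    the quotient under the logarithm is genuine, and the lower bound on [t] becomes the comparison
    of [d] with [s] required by [integral_cutoff_sum_powR]. *)
Lemma integral_cutoff_powR_le (r p t : R) : 1 <= r -> r <= p ->
  let s := fine (weak_moment r X p) in
  (32 * C_gap + 1) * r * ln ((\sum_(i < n) coord_L2 X i `^ r) `^ r^-1 / s) <= t ->
  (\int[P]_w ((\sum_(i < n) cutoff (coord_L2 X) r t i w) `^ (p / r))%:E <=
   (((2 * C_step + 1) * r * s) `^ p)%:E)%E.
Proof.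
move=> r1 rp s; set d := (\sum_(i < n) _) `^ _ => ht.
have r0 : 0 < r by lra.
have p0 : 0 < p by lra.
have pr0 : 0 < p / r by rewrite divr_gt0.
have g0 : 0 < C_gap by exact: C_gap_gt0.
have c0 : 0 < C_step by exact: C_step_gt0.
have mS : measurable_fun setT (fun w => (cutoff_sum (coord_L2 X) r t w `^ (p / r))%:E).
  apply/measurable_EFinP; apply: (measurableT_comp (f := fun x => x `^ (p / r))) => //.
  exact: measurable_cutoff_sum.
have -> : (\int[P]_w ((\sum_(i < n) cutoff (coord_L2 X) r t i w) `^ (p / r))%:E =
    \int[P]_w (cutoff_sum (coord_L2 X) r t w `^ (p / r))%:E)%E.
  apply: ae_eq_integral => //.
    apply/measurable_EFinP; apply: (measurableT_comp (f := fun x => x `^ (p / r))) => //.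
    by apply: measurable_sum => i; exact: measurable_cutoff.
  by apply: filterS (cutoff_sum_ae t r0) => w -> _.
have [/existsP[i di0]|noi] := boolP [exists i, 0 < coord_L2 X i]; last first.
  rewrite integral0_eq ?lee_fin ?powR_ge0// => w _.
  rewrite /cutoff_sum big_pred0 ?powR0 ?gt_eqF// => i.
  by apply/negbTE; move: noi; rewrite negb_exists => /forallP.
have s0 : 0 < s := weak_moment_gt0 r1 rp di0.
pose t' := Num.max t (16 * r * C_gap).
have tt' : t <= t' by rewrite le_max lexx.
have t'r : 16 * r * C_gap <= t' by rewrite le_max lexx orbT.
have t'E : t < t' -> t' = 16 * r * C_gap.
  by rewrite /t' lt_max ltxx /= => h; rewrite max_r// ltW.
apply: le_trans (integral_cutoff_sum_powR _ r1 rp s0 _ tt' t'r t'E _) _.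
- by move=> j; rewrite J_sqr_coord.
- by move=> u; exact: weak_moment_bound.
- pose S := \sum_(i < n) coord_L2 X i `^ r.
  have S0 : 0 < S.
    rewrite /S (bigD1 i)//=; apply: ltr_pwDl; first exact: powR_gt0.
    apply: sumr_ge0 => j _.
    exact: powR_ge0.
  have dS : d `^ r = S by rewrite /d -powRrM mulVf ?gt_eqF// powRr1// ltW.
  have d0 : 0 < d by rewrite /d powR_gt0.
  apply: (@le_trans _ _ S).
    rewrite /S [leLHS]big_mkcond; apply: ler_sum => j _.
    by case: ifP => // _; exact: powR_ge0.
  rewrite -dS; apply: ge0_ler_powR; rewrite ?nnegrE ?(ltW r0) ?(ltW d0)//.
    by rewrite mulr_ge0 ?expR_ge0// ltW.
  rewrite mulrC -ler_pdivrMr// -[leLHS]lnK ?posrE ?divr_gt0// ler_expR.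
  have rg0 : 0 < 32 * C_gap * r by rewrite !mulr_gt0.
  rewrite ler_pdivlMr//; have : 0 < 16 * r * C_gap by rewrite !mulr_gt0.
  (* The goal is [ln (d / s) * (32 * C_gap * r) <= t']; for a nonpositive logarithm it follows from
     [t' > 0] alone. *)
  have [L0|L0] := leP (ln (d / s)) 0; first nra.
  have : 0 < r * ln (d / s) by rewrite mulr_gt0.
  lra.
rewrite lee_fin; apply: ge0_ler_powR; rewrite ?nnegrE ?(ltW p0) ?mulr_ge0//; try lra.
by rewrite !ler_wpM2r//; lra.
Qed.

End Law.

Theorem theorem6 (R : realType) :
  exists C3 C4 : R, 1 <= C3 /\ 1 <= C4 /\
  forall (r : R) (n : nat) (disp : measure_display) (T : measurableType disp)
    (P : probability T R) (X : 'I_n -> {RV P >-> R}),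
  1 <= r -> log_concave X ->
  let d_ := coord_L2 X in
  let d := (\sum_(i < n) d_ i `^ r) `^ r^-1 in
  forall p : R, r <= p ->
  let sigma := fine (weak_moment r X p) in
  forall t : R, C4 * r * ln (d / sigma) <= t ->
  ('E_P[fun w =>
      ((\sum_(i < n) `|X i w| `^ r * \1_[set w' | t * d_ i <= `|X i w'|] w)
        `^ (p / r))%R]
   <= ((C3 * r * sigma) `^ p)%:E)%E.

Proof.
(* Adding 1 ensures that both constants are at least 1. *)
exists (2 * C_step + 1), (32 * C_gap + 1).
have c0 : 0 < C_step :> R by exact: C_step_gt0.
have g0 : 0 < C_gap :> R by exact: C_gap_gt0.
do 2 (split; first by lra).
move=> r n disp T P X r1 lcX d_ d p rp sigma t ht.
by rewrite unlock; apply: (integral_cutoff_powR_le lcX r1 rp ht).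
Qed.
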